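(* Work in $\mathrm{ZF}$. If $\mathbb{VP}$ holds but $\mathrm{OR}$ is not Mahlo, then there are unboundedly many rank-Berkeley cardinals.
   Context: In $\mathrm{ZF}$, a cardinal $\kappa$ is inaccessible iff there is no cofinal map $f:V_\alpha\to\kappa$ for any $\alpha<\kappa$. ''$\mathrm{OR}$ is not Mahlo'' means some proper club class of ordinals definable with parameters contains no inaccessible cardinal. $\mathbb{VP}$ is the schema: for every proper class $\mathcal{C}$ of structures of the same type definable with arbitrary set parameters, there exist $A\neq B$ in $\mathcal{C}$ and an elementary embedding of $A$ into $B$. A cardinal $\delta$ is $\zeta$-proto rank-Berkeley (for $\zeta<\delta$) iff for every $\lambda>\delta$ there is an elementary embedding $j:V_\lambda\to V_\lambda$ with $\zeta<\operatorname{crit} j<\delta$ and $j(\delta)=\delta$; $\delta$ is rank-Berkeley iff it is $\zeta$-proto rank-Berkeley for all $\zeta<\delta$. *)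

(* Defs.v *)
Set Implicit Arguments.
Unset Strict Implicit.
Unset Printing Implicit Defensive.

(* A theorem schema of ZF is read as a statement about all first-order models
   [M] of ZF.  Schemas (Separation, Replacement, VP, definable clubs) range over
   the external formulas below; every other notion is the usual set-theoretic
   one relativized to [M], so "set", "function", "formula", "elementary
   embedding" and so on mean elements of [M].  [M] need not be well-founded and
   its natural numbers may be nonstandard, hence the satisfaction relation used
   for elementary embeddings is the one internal to [M].  No choice is assumed
   in [M]. *)

Record set_model := SetModel {
  carrier :> Type;
  mem : carrier -> carrier -> Prop
}.

Notation "x ∈ y" := (mem x y) (at level 70, no associativity).

(* External formulas; variables are de Bruijn indices. *)
Inductive formula : Type :=
| fmem (i j : nat)
| feq (i j : nat)
| fbot
| fimp (p q : formula)
| fall (p : formula).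

Definition scons {X : Type} (x : X) (e : nat -> X) (n : nat) : X :=
  match n with 0 => x | S k => e k end.

Fixpoint holds {M : set_model} (e : nat -> M) (p : formula) : Prop :=
  match p with
  | fmem i j => e i ∈ e j
  | feq i j => e i = e j
  | fbot => False
  | fimp p q => holds e p -> holds e q
  | fall p => forall x : M, holds (scons x e) p
  end.

(* The parameters are the values of [e]; a formula uses finitely many. *)
Definition definable {M : set_model} (C : M -> Prop) : Prop :=
  exists (p : formula) (e : nat -> M), forall x, C x <-> holds (scons x e) p.

Definition definable2 {M : set_model} (R : M -> M -> Prop) : Prop :=
  exists (p : formula) (e : nat -> M),
    forall x y, R x y <-> holds (scons x (scons y e)) p.

Definition proper_class {M : set_model} (C : M -> Prop) : Prop :=
  ~ exists a : M, forall x, x ∈ a <-> C x.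

Definition subset {M : set_model} (x y : M) : Prop :=
  forall z, z ∈ x -> z ∈ y.

Definition is_empty {M : set_model} (x : M) : Prop := forall z, ~ z ∈ x.

Definition is_pair {M : set_model} (a b p : M) : Prop :=
  forall z, z ∈ p <-> z = a \/ z = b.

(* Kuratowski: p = {{a}, {a, b}} *)
Definition is_opair {M : set_model} (a b p : M) : Prop :=
  exists u v, is_pair a a u /\ is_pair a b v /\ is_pair u v p.

Definition is_succ {M : set_model} (a s : M) : Prop :=
  forall z, z ∈ s <-> z ∈ a \/ z = a.

Definition inductive {M : set_model} (w : M) : Prop :=
  (forall z, is_empty z -> z ∈ w) /\
  (forall n s, n ∈ w -> is_succ n s -> s ∈ w).

Definition is_omega {M : set_model} (w : M) : Prop :=
  inductive w /\ forall z, inductive z -> subset w z.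

Fixpoint is_numeral {M : set_model} (k : nat) (x : M) : Prop :=
  match k with
  | 0 => is_empty x
  | S k => exists y, is_numeral k y /\ is_succ y x
  end.

Record ZF (M : set_model) : Prop := {
  ZF_extensionality :
    forall x y : M, (forall z, z ∈ x <-> z ∈ y) -> x = y;
  ZF_foundation :
    forall x : M, (exists y, y ∈ x) ->
      exists y, y ∈ x /\ forall z, z ∈ x -> ~ z ∈ y;
  ZF_pairing :
    forall a b : M, exists p, is_pair a b p;
  ZF_union :
    forall a : M, exists u, forall x, x ∈ u <-> exists y, y ∈ a /\ x ∈ y;
  ZF_powerset :
    forall a : M, exists p, forall x, x ∈ p <-> subset x a;
  ZF_infinity :
    exists w : M, (exists z, is_empty z /\ z ∈ w) /\
      forall n, n ∈ w -> exists s, is_succ n s /\ s ∈ w;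
  ZF_separation :
    forall C : M -> Prop, definable C ->
      forall a, exists b, forall x, x ∈ b <-> x ∈ a /\ C x;
  ZF_replacement :
    forall R : M -> M -> Prop, definable2 R ->
      forall a, (forall x, x ∈ a -> forall y y', R x y -> R x y' -> y = y') ->
      exists b, forall y, y ∈ b <-> exists x, x ∈ a /\ R x y
}.

Definition pair_in {M : set_model} (x y f : M) : Prop :=
  exists p, is_opair x y p /\ p ∈ f.

Definition maps {M : set_model} (f x y : M) : Prop := pair_in x y f.

Definition is_fun {M : set_model} (f X Y : M) : Prop :=
  (forall p, p ∈ f -> exists x y, x ∈ X /\ y ∈ Y /\ is_opair x y p) /\
  (forall x, x ∈ X -> exists! y, maps f x y).

Definition is_fun_on {M : set_model} (f X : M) : Prop :=
  exists Y, is_fun f X Y.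

Definition bijection {M : set_model} (f X Y : M) : Prop :=
  is_fun f X Y /\
  (forall x x' y, maps f x y -> maps f x' y -> x = x') /\
  (forall y, y ∈ Y -> exists x, maps f x y).

Definition transitive {M : set_model} (x : M) : Prop :=
  forall y, y ∈ x -> subset y x.

(* Well-foundedness of ∈ on [x] is the axiom of foundation. *)
Definition ordinal {M : set_model} (x : M) : Prop :=
  transitive x /\
  forall y z, y ∈ x -> z ∈ x -> y ∈ z \/ y = z \/ z ∈ y.

Definition cardinal {M : set_model} (k : M) : Prop :=
  ordinal k /\ forall a, a ∈ k -> ~ exists f, bijection f a k.

(* v = V_a: f is the function on a + 1 with f(b) = ⋃_(c < b) P(f(c)). *)
Definition is_V {M : set_model} (a v : M) : Prop :=
  ordinal a /\
  exists s f, is_succ a s /\ is_fun_on f s /\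
    (forall b u, maps f b u ->
       forall x, x ∈ u <-> exists c w, c ∈ b /\ maps f c w /\ subset x w) /\
    maps f a v.

Definition cofinal_map {M : set_model} (f X k : M) : Prop :=
  is_fun f X k /\
  forall b, b ∈ k -> exists x c, x ∈ X /\ maps f x c /\ (b ∈ c \/ b = c).

(* Uncountability is not required: 0, 1 and ω satisfy this definition.  Cutting
   an initial segment off a club shows that this does not affect whether OR is
   Mahlo. *)
Definition inaccessible {M : set_model} (k : M) : Prop :=
  cardinal k /\
  forall a v, a ∈ k -> is_V a v -> ~ exists f, cofinal_map f v k.

Definition club_class {M : set_model} (C : M -> Prop) : Prop :=
  (forall a, C a -> ordinal a) /\
  (forall a, ordinal a -> exists b, C b /\ a ∈ b) /\
  (forall d, ordinal d -> (exists a, a ∈ d) ->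
     (forall a, a ∈ d -> exists b, b ∈ d /\ C b /\ a ∈ b) -> C d).

Definition OR_not_Mahlo (M : set_model) : Prop :=
  exists C : M -> Prop,
    definable C /\ proper_class C /\ club_class C /\
    forall k, C k -> ~ inaccessible k.

(* A type of structures: functions in [M] giving the arities, in ω, of a set of
   relation symbols and a set of function symbols (constants have arity 0). *)
Record signature (M : set_model) := Signature {
  rel_arity : M;
  fun_arity : M
}.

Definition is_signature {M : set_model} (L : signature M) : Prop :=
  exists w D D', is_omega w /\
    is_fun (rel_arity L) D w /\ is_fun (fun_arity L) D' w.

Record structure (M : set_model) := Structure {
  univ : M;
  rels : M;
  funs : M
}.

Definition codes_structure {M : set_model} (s : M) (A : structure M) : Prop :=
  exists p, is_opair (rels A) (funs A) p /\ is_opair (univ A) p s.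

(* n-tuples are functions with domain n. *)
Definition is_structure {M : set_model} (L : signature M) (A : structure M)
  : Prop :=
  (exists x, x ∈ univ A) /\
  (exists w D, is_omega w /\ is_fun (rel_arity L) D w /\ is_fun_on (rels A) D) /\
  (exists w D, is_omega w /\ is_fun (fun_arity L) D w /\ is_fun_on (funs A) D) /\
  (forall r n R, maps (rel_arity L) r n -> maps (rels A) r R ->
     forall s, s ∈ R -> is_fun s n (univ A)) /\
  (forall f n F, maps (fun_arity L) f n -> maps (funs A) f F ->
     exists P, (forall s, s ∈ P <-> is_fun s n (univ A)) /\
       is_fun F P (univ A)).

Definition tag {M : set_model} (k : nat) (x c : M) : Prop :=
  exists t, is_numeral k t /\ is_opair t x c.

Definition tag2 {M : set_model} (k : nat) (x y c : M) : Prop :=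
  exists p, is_opair x y p /\ tag k p c.

(* Codes of terms: v_n is (0, n), f(u) is (1, (f, u)) with u a tuple of terms.
   Codes of formulas: t = u is (0, (t, u)), r(u) is (1, (r, u)), ¬φ is (2, φ),
   φ ∧ ψ is (3, (φ, ψ)), ∃v_n φ is (4, (n, φ)).
   Inductively defined sets are expressed as membership in every set of [M]
   closed under the defining clauses; ZF proves that such closed sets exist. *)

Definition var_code {M : set_model} (n c : M) : Prop := tag 0 n c.
Definition app_code {M : set_model} (f u c : M) : Prop := tag2 1 f u c.
Definition eq_code {M : set_model} (t u c : M) : Prop := tag2 0 t u c.
Definition rel_code {M : set_model} (r u c : M) : Prop := tag2 1 r u c.
Definition neg_code {M : set_model} (p c : M) : Prop := tag 2 p c.
Definition and_code {M : set_model} (p q c : M) : Prop := tag2 3 p q c.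
Definition ex_code {M : set_model} (n p c : M) : Prop := tag2 4 n p c.

Definition natural {M : set_model} (n : M) : Prop :=
  exists w, is_omega w /\ n ∈ w.

Definition term_closed {M : set_model} (L : signature M) (Z : M) : Prop :=
  (forall n c, natural n -> var_code n c -> c ∈ Z) /\
  (forall f n u c, maps (fun_arity L) f n -> is_fun u n Z ->
     app_code f u c -> c ∈ Z).

Definition is_term {M : set_model} (L : signature M) (t : M) : Prop :=
  forall Z, term_closed L Z -> t ∈ Z.

Definition assignment {M : set_model} (A : structure M) (s : M) : Prop :=
  exists w, is_omega w /\ is_fun s w (univ A).

Definition eval_closed {M : set_model} (L : signature M) (A : structure M)
    (s Z : M) : Prop :=
  (forall n a c, maps s n a -> var_code n c -> pair_in c a Z) /\
  (forall f n F u b y c,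
     maps (fun_arity L) f n -> maps (funs A) f F ->
     is_fun_on u n -> is_fun b n (univ A) ->
     (forall i t a, maps u i t -> maps b i a -> pair_in t a Z) ->
     maps F b y -> app_code f u c -> pair_in c y Z).

Definition eval {M : set_model} (L : signature M) (A : structure M)
    (s t y : M) : Prop :=
  forall Z, eval_closed L A s Z -> pair_in t y Z.

Definition is_comprehension {M : set_model} (A : structure M)
    (P : M -> Prop) (D : M) : Prop :=
  forall s, s ∈ D <-> assignment A s /\ P s.

(* Tarski's clauses, for the relation "D is the set of all assignments that
   satisfy φ". *)
Definition den_closed {M : set_model} (L : signature M) (A : structure M)
    (Z : M) : Prop :=
  (forall t u c D, is_term L t -> is_term L u -> eq_code t u c ->
     is_comprehension A
       (fun s => exists y, eval L A s t y /\ eval L A s u y) D ->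
     pair_in c D Z) /\
  (forall r n R u c D, maps (rel_arity L) r n -> maps (rels A) r R ->
     is_fun_on u n -> (forall i t, maps u i t -> is_term L t) ->
     rel_code r u c ->
     is_comprehension A
       (fun s => exists b, b ∈ R /\
          forall i t a, maps u i t -> maps b i a -> eval L A s t a) D ->
     pair_in c D Z) /\
  (forall p E c D, pair_in p E Z -> neg_code p c ->
     is_comprehension A (fun s => ~ s ∈ E) D ->
     pair_in c D Z) /\
  (forall p q E E' c D, pair_in p E Z -> pair_in q E' Z -> and_code p q c ->
     is_comprehension A (fun s => s ∈ E /\ s ∈ E') D ->
     pair_in c D Z) /\
  (forall n p E c D, natural n -> pair_in p E Z -> ex_code n p c ->
     is_comprehension A
       (fun s => exists s', s' ∈ E /\
          forall m a, m <> n -> (maps s m a <-> maps s' m a)) D ->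
     pair_in c D Z).

Definition denotes {M : set_model} (L : signature M) (A : structure M)
    (p D : M) : Prop :=
  forall Z, den_closed L A Z -> pair_in p D Z.

(* A ⊨ φ[s] *)
Definition sat {M : set_model} (L : signature M) (A : structure M)
    (p s : M) : Prop :=
  exists D, denotes L A p D /\ s ∈ D.

Definition is_image_assignment {M : set_model} (j s s' : M) : Prop :=
  forall n a b, maps s n a -> maps j a b -> maps s' n b.

Definition formula_closed {M : set_model} (L : signature M) (Z : M) : Prop :=
  (forall t u c, is_term L t -> is_term L u -> eq_code t u c -> c ∈ Z) /\
  (forall r n u c, maps (rel_arity L) r n -> is_fun_on u n ->
     (forall i t, maps u i t -> is_term L t) -> rel_code r u c -> c ∈ Z) /\
  (forall p c, p ∈ Z -> neg_code p c -> c ∈ Z) /\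
  (forall p q c, p ∈ Z -> q ∈ Z -> and_code p q c -> c ∈ Z) /\
  (forall n p c, natural n -> p ∈ Z -> ex_code n p c -> c ∈ Z).

Definition is_formula {M : set_model} (L : signature M) (p : M) : Prop :=
  forall Z, formula_closed L Z -> p ∈ Z.

Definition elementary {M : set_model} (L : signature M) (A B : structure M)
    (j : M) : Prop :=
  is_fun j (univ A) (univ B) /\
  forall p s s', is_formula L p -> assignment A s -> assignment B s' ->
    is_image_assignment j s s' ->
    (sat L A p s <-> sat L B p s').

Definition VP (M : set_model) : Prop :=
  forall (L : signature M) (C : M -> Prop),
    is_signature L -> definable C -> proper_class C ->
    (forall s, C s -> exists A, codes_structure s A /\ is_structure L A) ->
    exists s t A B j,
      C s /\ C t /\ s <> t /\ codes_structure s A /\ codes_structure t B /\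
      elementary L A B j.

(* The signature with one binary relation symbol, 0. *)
Definition set_signature {M : set_model} (L : signature M) : Prop :=
  (forall p, p ∈ rel_arity L <->
     exists z t, is_numeral 0 z /\ is_numeral 2 t /\ is_opair z t p) /\
  is_empty (fun_arity L).

Definition is_mem_relation {M : set_model} (v R : M) : Prop :=
  forall s, s ∈ R <->
    (exists t, is_numeral 2 t /\ is_fun s t v) /\
    (exists i0 i1 x y, is_numeral 0 i0 /\ is_numeral 1 i1 /\
       maps s i0 x /\ maps s i1 y /\ x ∈ y).

Definition is_mem_structure {M : set_model} (v : M) (A : structure M) : Prop :=
  univ A = v /\
  (forall p, p ∈ rels A <->
     exists z R, is_numeral 0 z /\ is_mem_relation v R /\ is_opair z R p) /\
  is_empty (funs A).

Definition rank_embedding {M : set_model} (l j : M) : Prop :=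
  exists v L A, is_V l v /\ set_signature L /\ is_mem_structure v A /\
    elementary L A A j.

Definition is_crit {M : set_model} (j k : M) : Prop :=
  ordinal k /\ (exists k', maps j k k' /\ k' <> k) /\
  forall a, a ∈ k -> maps j a a.

Definition proto_rank_Berkeley {M : set_model} (z d : M) : Prop :=
  cardinal d /\ z ∈ d /\
  forall l, ordinal l -> d ∈ l ->
    exists j k, rank_embedding l j /\ is_crit j k /\ z ∈ k /\ k ∈ d /\
      maps j d d.

Definition rank_Berkeley {M : set_model} (d : M) : Prop :=
  cardinal d /\ forall z, z ∈ d -> proto_rank_Berkeley z d.

(* Main.v *)
(* Let C be a definable club of ordinals without inaccessibles.  To each l in C
   attach a structure on V_h, for a suitable limit h > l, with l and the
   ordinals up to a as constants and a few definable relations of the universe.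
   VP gives j from the structure of l to that of m, with l <> m and j(l) = m, so
   j has a critical point k with a < k <= l.  As usual k is inaccessible, so k is
   not in C and, C being closed, some b < k has no element of C between b and k.
   The least element of C above b is then a fixed point of j, it lies above k,
   and it is below l because l is moved.

   Let d be the least fixed point of j above k; then d < l.  A witness to
   |d| < d, or the least z < d for which d is not z-proto rank-Berkeley, is
   definable from d, hence fixed, hence below k by minimality of d.  The former is
   impossible: if f maps |d| < k onto d, then so does j(f), but its values are of
   the form j(y) and omit k.  In the latter case the least stage b at which
   z-proto rank-Berkeleyness fails is fixed too, and the restriction of j to V_b
   is an embedding with critical point k, z < k < d, that fixes d.  So d is
   rank-Berkeley. *)

Require Import Defs.
From Stdlib Require Import Classical ClassicalEpsilon Arith Lia List.
Set Implicit Arguments.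
Unset Strict Implicit.
Unset Printing Implicit Defensive.

(** Since [M] may have nonstandard formulas, elementarity is meant in the sense of its internal
    satisfaction relation, about which hardly anything is proved here. The relations of the
    structures are evaluated in all of [M] rather than in V_h, so no absoluteness or reflection
    argument arises and only atomic formulas are transferred along j. To see conversely that the
    restriction of j to V_b is elementary for every internal formula, satisfaction in (V_b, ∈) is
    made one of the relations: j fixes V_b and every formula code, and it acts pointwise on
    assignments. Fixing the codes, nonstandard ones included, requires every internal natural number
    to lie below the critical point; this follows because emptiness and successor are among the
    relations and [om] is among the symbols. The height h has to be a function of l, because VP
    delivers j, and with it d, only afterwards. Under choice Kunen's theorem would exclude a fixed
    ordinal above the critical point so far below h; in ZF there is no such obstruction, and the
    proof lives on this ordinal. *)

Fixpoint rename (r : nat -> nat) (p : formula) : formula :=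
  match p with
  | fmem i j => fmem (r i) (r j)
  | feq i j => feq (r i) (r j)
  | fbot => fbot
  | fimp p q => fimp (rename r p) (rename r q)
  | fall p =>
      fall (rename (fun n => match n with 0 => 0 | S k => S (r k) end) p)
  end.

Lemma holds_rename {M : set_model} (p : formula) :
  forall (r : nat -> nat) (e e' : nat -> M), (forall n, e' (r n) = e n) ->
  (holds e' (rename r p) <-> holds e p).
Proof.
induction p as [i j|i j| |p IHp q IHq|p IHp]; intros r e e' H; simpl.
- rewrite !H; tauto.
- rewrite !H; tauto.
- tauto.
- rewrite (IHp r e e' H), (IHq r e e' H); tauto.
- assert (forall x, holds (scons x e') (rename
    (fun n => match n with 0 => 0 | S k => S (r k) end) p)
    <-> holds (scons x e) p) as Hx.
  { intro x; apply IHp; intros [|n]; simpl; auto. }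
  split; intros G x; apply Hx; apply G.
Qed.

Definition interleave {X : Type} (e a : nat -> X) (n : nat) : X :=
  if Nat.even n then e (Nat.div2 n) else a (Nat.div2 n).

Lemma interleave_even {X : Type} (e a : nat -> X) n :
  interleave e a (2 * n) = e n.
Proof.
unfold interleave.
rewrite Nat.even_mul, Nat.div2_double; reflexivity.
Qed.

Lemma interleave_odd {X : Type} (e a : nat -> X) n :
  interleave e a (S (2 * n)) = a n.
Proof.
unfold interleave.
rewrite Nat.even_succ, <- Nat.negb_even, Nat.even_mul, Nat.div2_succ_double.
reflexivity.
Qed.

Lemma even_odd_ind (P : nat -> Prop) :
  (forall k, P (2 * k)) -> (forall k, P (S (2 * k))) -> forall n, P n.
Proof.
intros H0 H1 n.
destruct (Nat.Even_or_Odd n) as [[k ->]|[k ->]]; auto.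
rewrite Nat.add_1_r; auto.
Qed.

(* Variables are read from even positions and parameters from odd ones, so
   that neither the number of free variables nor that of parameters has to be
   tracked. *)
Definition dfn {M : set_model} (P : (nat -> M) -> Prop) : Prop :=
  M -> exists p a, forall e, P e <-> holds (interleave e a) p.

(** External formulas have no terms besides variables and parameters. A predicate that mentions an
    operation such as [sc] or [V] therefore has to be restated with the corresponding relation
    before it is recognized as definable. *)
Definition is_arg {M : set_model} (t : (nat -> M) -> M) : Prop :=
  (exists i, forall e, t e = e i) \/ (exists c, forall e, t e = c).

(** * Definability *)

Section Definability.

Context {M : set_model}.
Implicit Types (P Q : (nat -> M) -> Prop) (t u : (nat -> M) -> M).

Lemma dfn_ext P Q : (forall e, P e <-> Q e) -> dfn P -> dfn Q.
Proof.
intros H HP m; destruct (HP m) as [p [a Hp]].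
exists p, a; intro e; rewrite <- H; apply Hp.
Qed.

(** The caller chooses the parameter slot [k], so that the two sides of an atom can use different
    slots. A variable needs no slot, and [m] then serves as filler. *)
Lemma is_arg_index (k : nat) (m : M) t :
  is_arg t -> exists i c, forall e a, a k = c -> t e = interleave e a i.
Proof.
intros [[i H]|[c H]].
- exists (2 * i), m; intros e a _.
  rewrite interleave_even; auto.
- exists (S (2 * k)), c; intros e a Ha.
  rewrite interleave_odd, H; auto.
Qed.

Lemma dfn_atom (R : M -> M -> Prop) (f : nat -> nat -> formula) t u :
  (forall i j (e : nat -> M), holds e (f i j) <-> R (e i) (e j)) ->
  is_arg t -> is_arg u -> dfn (fun e => R (t e) (u e)).
Proof.
intros Hf Ht Hu m.
destruct (is_arg_index 0 m Ht) as [i [c Hi]].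
destruct (is_arg_index 1 m Hu) as [j [d Hj]].
exists (f i j), (scons c (fun _ => d)); intro e.
rewrite Hf, (Hi e (scons c (fun _ => d)) eq_refl).
rewrite (Hj e (scons c (fun _ => d)) eq_refl).
reflexivity.
Qed.

Lemma dfn_mem t u : is_arg t -> is_arg u -> dfn (fun e => t e ∈ u e).
Proof. apply (dfn_atom (f := fmem)); reflexivity. Qed.

Lemma dfn_eq t u : is_arg t -> is_arg u -> dfn (fun e => t e = u e).
Proof. apply (dfn_atom (f := feq)); reflexivity. Qed.

Lemma dfn_False : dfn (fun _ : nat -> M => False).
Proof.
intro m; exists fbot, (fun _ => m); simpl; tauto.
Qed.

Lemma dfn_imp P Q : dfn P -> dfn Q -> dfn (fun e => P e -> Q e).
Proof.
intros HP HQ m.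
destruct (HP m) as [p [a Hp]], (HQ m) as [q [b Hq]].
(* The parameter lists are themselves interleaved: parameter [k], read at [2 * k + 1], moves to
   [4 * k + 1] in [p] and to [4 * k + 3] in [q]. *)
exists (fimp (rename (fun n => if Nat.even n then n else 2 * n - 1) p)
             (rename (fun n => if Nat.even n then n else 2 * n + 1) q)),
  (interleave a b).
intro e; cbn [holds].
rewrite (@holds_rename M p _ (interleave e a)).
2:{ intro n; pattern n; apply even_odd_ind; intro k.
    - rewrite Nat.even_mul; simpl orb; cbv iota.
      rewrite !interleave_even; reflexivity.
    - rewrite Nat.even_succ, <- Nat.negb_even, Nat.even_mul.
      simpl orb; simpl negb; cbv iota.
      replace (2 * S (2 * k) - 1) with (S (2 * (2 * k))) by lia.
      rewrite !interleave_odd, interleave_even; reflexivity. }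
rewrite (@holds_rename M q _ (interleave e b)).
2:{ intro n; pattern n; apply even_odd_ind; intro k.
    - rewrite Nat.even_mul; simpl orb; cbv iota.
      rewrite !interleave_even; reflexivity.
    - rewrite Nat.even_succ, <- Nat.negb_even, Nat.even_mul.
      simpl orb; simpl negb; cbv iota.
      replace (2 * S (2 * k) + 1) with (S (2 * (S (2 * k)))) by lia.
      rewrite !interleave_odd; reflexivity. }
rewrite Hp, Hq; tauto.
Qed.

Lemma dfn_all (P : (nat -> M) -> M -> Prop) :
  dfn (fun e => P (fun n => e (S n)) (e 0)) -> dfn (fun e => forall x, P e x).
Proof.
intros HP m; destruct (HP m) as [p [a Hp]].
(* The body reads the outer variable [i] at [2 * S i]. Under the quantifier that variable sits at
   [S (2 * i)], one position lower, whereas parameters move one position up. *)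
exists (fall (rename (fun n => match n with 0 => 0
   | S k => if Nat.even n then k else S n end) p)), a.
intro e; cbn [holds].
assert (forall x, P e x <-> holds (scons x (interleave e a))
  (rename (fun n => match n with 0 => 0
   | S k => if Nat.even n then k else S n end) p)) as Hx.
{ intro x.
  rewrite (@holds_rename M p _ (interleave (scons x e) a)).
  - rewrite <- Hp; simpl; tauto.
  - intro n; pattern n; apply even_odd_ind; intros [|k].
    + reflexivity.
    + rewrite interleave_even.
      replace (2 * S k) with (S (S (2 * k))) by lia.
      rewrite Nat.even_succ_succ, Nat.even_mul.
      exact (interleave_even e a k).
    + reflexivity.
    + rewrite interleave_odd.
      rewrite Nat.even_succ, <- Nat.negb_even, Nat.even_mul.
      exact (interleave_odd e a (S k)). }
split; intros H x; apply Hx, H.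
Qed.

Lemma dfn_holds (p : formula) (a : nat -> M) t :
  is_arg t -> dfn (fun e => holds (scons (t e) a) p).
Proof.
intros [[i Hi]|[c Hc]] _.
- exists (rename (fun n => match n with 0 => 2 * i | S k => S (2 * k) end) p),
    a.
  intro e; symmetry; apply holds_rename; intros [|k].
  + rewrite interleave_even; symmetry; apply Hi.
  + rewrite interleave_odd; reflexivity.
- exists (rename (fun n => S (2 * n)) p), (scons c a).
  intro e; symmetry; apply holds_rename; intro k.
  rewrite interleave_odd, <- (Hc e); reflexivity.
Qed.

Lemma dfn_not P : dfn P -> dfn (fun e => ~ P e).
Proof. intro H; apply dfn_imp; [exact H | exact dfn_False]. Qed.

Lemma dfn_and P Q : dfn P -> dfn Q -> dfn (fun e => P e /\ Q e).
Proof.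
intros HP HQ; apply (@dfn_ext (fun e => ~ (P e -> ~ Q e))).
- intro e; tauto.
- apply dfn_not, dfn_imp; [exact HP | apply dfn_not, HQ].
Qed.

Lemma dfn_or P Q : dfn P -> dfn Q -> dfn (fun e => P e \/ Q e).
Proof.
intros HP HQ; apply (@dfn_ext (fun e => ~ P e -> Q e)).
- intro e; tauto.
- apply dfn_imp; [apply dfn_not, HP | exact HQ].
Qed.

Lemma dfn_iff P Q : dfn P -> dfn Q -> dfn (fun e => P e <-> Q e).
Proof. intros HP HQ; apply dfn_and; apply dfn_imp; assumption. Qed.

Lemma dfn_ex (P : (nat -> M) -> M -> Prop) :
  dfn (fun e => P (fun n => e (S n)) (e 0)) -> dfn (fun e => exists x, P e x).
Proof.
intro H; apply (@dfn_ext (fun e => ~ forall x, ~ P e x)).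
- intro e; split.
  + intro G; apply NNPP; intro F; apply G; intros x Hx; apply F; eauto.
  + intros [x Hx] G; exact (G x Hx).
- apply dfn_not.
  apply (@dfn_all (fun e x => ~ P e x)), dfn_not, H.
Qed.

Lemma dfn_ex_signature (P : (nat -> M) -> signature M -> Prop) :
  dfn (fun e => exists r f, P e (Signature r f)) ->
  dfn (fun e => exists L, P e L).
Proof.
apply dfn_ext; intro e; split.
- intros [r [f H]]; eauto.
- intros [[r f] H]; eauto.
Qed.

Lemma dfn_ex_structure (P : (nat -> M) -> structure M -> Prop) :
  dfn (fun e => exists v r f, P e (Structure v r f)) ->
  dfn (fun e => exists A, P e A).
Proof.
apply dfn_ext; intro e; split.
- intros [v [r [f H]]]; eauto.
- intros [[u r f] H]; eauto.
Qed.

Lemma dfn_definable (C : M -> Prop) t :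
  definable C -> is_arg t -> dfn (fun e => C (t e)).
Proof.
intros [p [a H]] Ht.
apply (@dfn_ext (fun e => holds (scons (t e) a) p)).
- intro e; symmetry; apply H.
- apply dfn_holds, Ht.
Qed.

(** The predicate depends on [e 0] alone, so all variables can be identified with a single one. The
    element [m] only witnesses that the carrier is inhabited. *)
Lemma definable_dfn (m : M) (C : M -> Prop) : dfn (fun e => C (e 0)) -> definable C.
Proof.
intro HP; destruct (HP m) as [p [a H]].
exists (rename (fun n => if Nat.even n then 0 else S (Nat.div2 n)) p), a.
intro x; rewrite (H (fun _ => x)); symmetry; apply holds_rename.
intro n; unfold interleave; destruct (Nat.even n); reflexivity.
Qed.

Lemma definable2_dfn (m : M) (R : M -> M -> Prop) :
  dfn (fun e => R (e 0) (e 1)) -> definable2 R.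
Proof.
intro HP; destruct (HP m) as [p [a H]].
exists (rename (fun n => if Nat.even n
  then match Nat.div2 n with 0 => 0 | S _ => 1 end
  else S (S (Nat.div2 n))) p), a.
intros x y.
rewrite (H (fun n => match n with 0 => x | S _ => y end)).
symmetry; apply holds_rename.
intro n; unfold interleave; destruct (Nat.even n); [|reflexivity].
destruct (Nat.div2 n); reflexivity.
Qed.

End Definability.

(* Proof search for definability *)
Create HintDb dfn.

(** Passing under a quantifier turns [t] into [fun e => t (fun n => e (S n))], which has to be
    recognized as an argument again. *)
Lemma is_arg_rename {M : set_model} (t : (nat -> M) -> M) (r : nat -> nat) :
  is_arg t -> is_arg (fun e => t (fun n => e (r n))).
Proof.
intros [[i H]|[c H]]; [left; exists (r i) | right; exists c];
  intro e; rewrite H; reflexivity.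
Qed.

Ltac solve_arg :=
  cbv beta;
  solve [ assumption
        | match goal with H : is_arg _ |- _ => exact (is_arg_rename _ H) end
        | left; eexists; intro; reflexivity
        | right; eexists; intro; reflexivity ].

#[global] Hint Extern 1 (is_arg _) => solve_arg : dfn.

(** Only logical structure is decomposed; a defined notion is looked up in the hint database, so
    that each notion is analysed once and not at every occurrence. *)
Ltac dfn_step :=
  cbv beta;
  lazymatch goal with
  | |- is_arg _ => solve_arg
  | |- dfn (fun e => exists! x, _) => unfold unique
  | |- dfn (fun e => _ ∈ _) => apply dfn_mem
  | |- dfn (fun e => _ = _) => apply dfn_eq
  | |- dfn (fun e => False) => exact dfn_False
  | |- dfn (fun e => ~ _) => apply dfn_not
  | |- dfn (fun e => _ /\ _) => apply dfn_and
  | |- dfn (fun e => _ \/ _) => apply dfn_or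
  | |- dfn (fun e => _ <-> _) => apply dfn_iff
  | |- dfn (fun e => exists x : signature _, _) => apply dfn_ex_signature
  | |- dfn (fun e => exists x : structure _, _) => apply dfn_ex_structure
  | |- dfn (fun e => exists x, _) => apply dfn_ex
  | |- dfn (fun e => @?P e -> @?Q e) => apply dfn_imp
  | |- dfn (fun e => forall x, _) => apply dfn_all
  | |- dfn _ => solve [eauto 3 with dfn nocore]
  end.

(** Quantifying over all arguments [t] makes the notion stable under the shifts of variables at
    quantifiers, so that a hypothesis of this form applies anywhere inside a formula. *)
Definition dfn1 {M : set_model} (P : M -> Prop) : Prop :=
  forall t, is_arg t -> dfn (fun e => P (t e)).

Definition dfn2 {M : set_model} (R : M -> M -> Prop) : Prop :=
  forall t u, is_arg t -> is_arg u -> dfn (fun e => R (t e) (u e)).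

Ltac dfn_auto := unfold dfn1, dfn2 in *; intros; repeat dfn_step.

(** * Definability of the basic set-theoretic and model-theoretic notions *)

Lemma dfn_subset {M : set_model} (x : (nat -> M) -> M) (y : (nat -> M) -> M) :
  is_arg x -> is_arg y ->
  dfn (fun e => subset (x e) (y e)).
Proof. intros; unfold subset; dfn_auto. Qed.
#[global] Hint Resolve dfn_subset : dfn.

Lemma dfn_is_empty {M : set_model} (x : (nat -> M) -> M) :
  is_arg x ->
  dfn (fun e => is_empty (x e)).
Proof. intros; unfold is_empty; dfn_auto. Qed.
#[global] Hint Resolve dfn_is_empty : dfn.

Lemma dfn_is_pair {M : set_model} (a : (nat -> M) -> M) (b : (nat -> M) -> M)
    (p : (nat -> M) -> M) :
  is_arg a -> is_arg b -> is_arg p ->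
  dfn (fun e => is_pair (a e) (b e) (p e)).
Proof. intros; unfold is_pair; dfn_auto. Qed.
#[global] Hint Resolve dfn_is_pair : dfn.

Lemma dfn_is_opair {M : set_model} (a : (nat -> M) -> M) (b : (nat -> M) -> M)
    (p : (nat -> M) -> M) :
  is_arg a -> is_arg b -> is_arg p ->
  dfn (fun e => is_opair (a e) (b e) (p e)).
Proof. intros; unfold is_opair; dfn_auto. Qed.
#[global] Hint Resolve dfn_is_opair : dfn.

Lemma dfn_is_succ {M : set_model} (a : (nat -> M) -> M) (s : (nat -> M) -> M) :
  is_arg a -> is_arg s ->
  dfn (fun e => is_succ (a e) (s e)).
Proof. intros; unfold is_succ; dfn_auto. Qed.
#[global] Hint Resolve dfn_is_succ : dfn.

Lemma dfn_inductive {M : set_model} (w : (nat -> M) -> M) :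
  is_arg w ->
  dfn (fun e => inductive (w e)).
Proof. intros; unfold inductive; dfn_auto. Qed.
#[global] Hint Resolve dfn_inductive : dfn.

Lemma dfn_is_omega {M : set_model} (w : (nat -> M) -> M) :
  is_arg w ->
  dfn (fun e => is_omega (w e)).
Proof. intros; unfold is_omega; dfn_auto. Qed.
#[global] Hint Resolve dfn_is_omega : dfn.

Lemma dfn_pair_in {M : set_model} (x : (nat -> M) -> M) (y : (nat -> M) -> M)
    (f : (nat -> M) -> M) :
  is_arg x -> is_arg y -> is_arg f ->
  dfn (fun e => pair_in (x e) (y e) (f e)).
Proof. intros; unfold pair_in; dfn_auto. Qed.
#[global] Hint Resolve dfn_pair_in : dfn.

Lemma dfn_is_fun {M : set_model} (f : (nat -> M) -> M) (X : (nat -> M) -> M)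
    (Y : (nat -> M) -> M) :
  is_arg f -> is_arg X -> is_arg Y ->
  dfn (fun e => is_fun (f e) (X e) (Y e)).
Proof. intros; unfold is_fun; dfn_auto. Qed.
#[global] Hint Resolve dfn_is_fun : dfn.

Lemma dfn_is_fun_on {M : set_model} (f : (nat -> M) -> M)
    (X : (nat -> M) -> M) :
  is_arg f -> is_arg X ->
  dfn (fun e => is_fun_on (f e) (X e)).
Proof. intros; unfold is_fun_on; dfn_auto. Qed.
#[global] Hint Resolve dfn_is_fun_on : dfn.

Lemma dfn_bijection {M : set_model} (f : (nat -> M) -> M)
    (X : (nat -> M) -> M) (Y : (nat -> M) -> M) :
  is_arg f -> is_arg X -> is_arg Y ->
  dfn (fun e => bijection (f e) (X e) (Y e)).
Proof. intros; unfold bijection; dfn_auto. Qed.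
#[global] Hint Resolve dfn_bijection : dfn.

Lemma dfn_transitive {M : set_model} (x : (nat -> M) -> M) :
  is_arg x ->
  dfn (fun e => transitive (x e)).
Proof. intros; unfold transitive; dfn_auto. Qed.
#[global] Hint Resolve dfn_transitive : dfn.

Lemma dfn_ordinal {M : set_model} (x : (nat -> M) -> M) :
  is_arg x ->
  dfn (fun e => ordinal (x e)).
Proof. intros; unfold ordinal; dfn_auto. Qed.
#[global] Hint Resolve dfn_ordinal : dfn.

Lemma dfn_is_V {M : set_model} (a : (nat -> M) -> M) (v : (nat -> M) -> M) :
  is_arg a -> is_arg v ->
  dfn (fun e => is_V (a e) (v e)).
Proof. intros; unfold is_V; dfn_auto. Qed.
#[global] Hint Resolve dfn_is_V : dfn.

Lemma dfn_cofinal_map {M : set_model} (f : (nat -> M) -> M)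
    (X : (nat -> M) -> M) (k : (nat -> M) -> M) :
  is_arg f -> is_arg X -> is_arg k ->
  dfn (fun e => cofinal_map (f e) (X e) (k e)).
Proof. intros; unfold cofinal_map; dfn_auto. Qed.
#[global] Hint Resolve dfn_cofinal_map : dfn.

Lemma dfn_is_numeral {M : set_model} (k : nat) : forall x : (nat -> M) -> M,
  is_arg x -> dfn (fun e => is_numeral k (x e)).
Proof.
induction k as [|k IH]; intros x Hx; cbn [is_numeral]; dfn_auto.
Qed.
#[global] Hint Resolve dfn_is_numeral : dfn.

Lemma dfn_tag {M : set_model} (k : nat) (x : (nat -> M) -> M)
    (c : (nat -> M) -> M) :
  is_arg x -> is_arg c ->
  dfn (fun e => tag k (x e) (c e)).
Proof. intros; unfold tag; dfn_auto. Qed.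
#[global] Hint Resolve dfn_tag : dfn.

Lemma dfn_tag2 {M : set_model} (k : nat) (x : (nat -> M) -> M)
    (y : (nat -> M) -> M) (c : (nat -> M) -> M) :
  is_arg x -> is_arg y -> is_arg c ->
  dfn (fun e => tag2 k (x e) (y e) (c e)).
Proof. intros; unfold tag2; dfn_auto. Qed.
#[global] Hint Resolve dfn_tag2 : dfn.

Lemma dfn_natural {M : set_model} (n : (nat -> M) -> M) :
  is_arg n ->
  dfn (fun e => natural (n e)).
Proof. intros; unfold natural; dfn_auto. Qed.
#[global] Hint Resolve dfn_natural : dfn.

(** A signature is an external record and not an element of the model, so the hypotheses are put on
    its components; structures are treated in the same way below. *)
Lemma dfn_term_closed {M : set_model} (L : (nat -> M) -> signature M)
    (Z : (nat -> M) -> M) :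
  is_arg (fun e => rel_arity (L e)) -> is_arg (fun e => fun_arity (L e)) ->
  is_arg Z ->
  dfn (fun e => term_closed (L e) (Z e)).
Proof. intros; unfold term_closed; dfn_auto. Qed.
#[global] Hint Resolve dfn_term_closed : dfn.

Lemma dfn_is_term {M : set_model} (L : (nat -> M) -> signature M)
    (t : (nat -> M) -> M) :
  is_arg (fun e => rel_arity (L e)) -> is_arg (fun e => fun_arity (L e)) ->
  is_arg t ->
  dfn (fun e => is_term (L e) (t e)).
Proof. intros; unfold is_term; dfn_auto. Qed.
#[global] Hint Resolve dfn_is_term : dfn.

Lemma dfn_assignment {M : set_model} (A : (nat -> M) -> structure M)
    (s : (nat -> M) -> M) :
  is_arg (fun e => univ (A e)) -> is_arg (fun e => rels (A e)) ->
  is_arg (fun e => funs (A e)) -> is_arg s ->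
  dfn (fun e => assignment (A e) (s e)).
Proof. intros; unfold assignment; dfn_auto. Qed.
#[global] Hint Resolve dfn_assignment : dfn.

Lemma dfn_eval_closed {M : set_model} (L : (nat -> M) -> signature M)
    (A : (nat -> M) -> structure M) (s : (nat -> M) -> M)
    (Z : (nat -> M) -> M) :
  is_arg (fun e => rel_arity (L e)) -> is_arg (fun e => fun_arity (L e)) ->
  is_arg (fun e => univ (A e)) -> is_arg (fun e => rels (A e)) ->
  is_arg (fun e => funs (A e)) -> is_arg s -> is_arg Z ->
  dfn (fun e => eval_closed (L e) (A e) (s e) (Z e)).
Proof. intros; unfold eval_closed; dfn_auto. Qed.
#[global] Hint Resolve dfn_eval_closed : dfn.

Lemma dfn_eval {M : set_model} (L : (nat -> M) -> signature M)
    (A : (nat -> M) -> structure M) (s : (nat -> M) -> M)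
    (t : (nat -> M) -> M) (y : (nat -> M) -> M) :
  is_arg (fun e => rel_arity (L e)) -> is_arg (fun e => fun_arity (L e)) ->
  is_arg (fun e => univ (A e)) -> is_arg (fun e => rels (A e)) ->
  is_arg (fun e => funs (A e)) -> is_arg s -> is_arg t -> is_arg y ->
  dfn (fun e => eval (L e) (A e) (s e) (t e) (y e)).
Proof. intros; unfold eval; dfn_auto. Qed.
#[global] Hint Resolve dfn_eval : dfn.

Lemma dfn_den_closed {M : set_model} (L : (nat -> M) -> signature M)
    (A : (nat -> M) -> structure M) (Z : (nat -> M) -> M) :
  is_arg (fun e => rel_arity (L e)) -> is_arg (fun e => fun_arity (L e)) ->
  is_arg (fun e => univ (A e)) -> is_arg (fun e => rels (A e)) ->
  is_arg (fun e => funs (A e)) -> is_arg Z ->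
  dfn (fun e => den_closed (L e) (A e) (Z e)).
Proof. intros; unfold den_closed, is_comprehension; dfn_auto. Qed.
#[global] Hint Resolve dfn_den_closed : dfn.

Lemma dfn_denotes {M : set_model} (L : (nat -> M) -> signature M)
    (A : (nat -> M) -> structure M) (p : (nat -> M) -> M)
    (D : (nat -> M) -> M) :
  is_arg (fun e => rel_arity (L e)) -> is_arg (fun e => fun_arity (L e)) ->
  is_arg (fun e => univ (A e)) -> is_arg (fun e => rels (A e)) ->
  is_arg (fun e => funs (A e)) -> is_arg p -> is_arg D ->
  dfn (fun e => denotes (L e) (A e) (p e) (D e)).
Proof. intros; unfold denotes; dfn_auto. Qed.
#[global] Hint Resolve dfn_denotes : dfn.

Lemma dfn_sat {M : set_model} (L : (nat -> M) -> signature M)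
    (A : (nat -> M) -> structure M) (p : (nat -> M) -> M)
    (s : (nat -> M) -> M) :
  is_arg (fun e => rel_arity (L e)) -> is_arg (fun e => fun_arity (L e)) ->
  is_arg (fun e => univ (A e)) -> is_arg (fun e => rels (A e)) ->
  is_arg (fun e => funs (A e)) -> is_arg p -> is_arg s ->
  dfn (fun e => sat (L e) (A e) (p e) (s e)).
Proof. intros; unfold sat; dfn_auto. Qed.
#[global] Hint Resolve dfn_sat : dfn.

Lemma dfn_is_image_assignment {M : set_model} (j : (nat -> M) -> M)
    (s : (nat -> M) -> M) (t : (nat -> M) -> M) :
  is_arg j -> is_arg s -> is_arg t ->
  dfn (fun e => is_image_assignment (j e) (s e) (t e)).
Proof. intros; unfold is_image_assignment; dfn_auto. Qed.
#[global] Hint Resolve dfn_is_image_assignment : dfn.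

Lemma dfn_formula_closed {M : set_model} (L : (nat -> M) -> signature M)
    (Z : (nat -> M) -> M) :
  is_arg (fun e => rel_arity (L e)) -> is_arg (fun e => fun_arity (L e)) ->
  is_arg Z ->
  dfn (fun e => formula_closed (L e) (Z e)).
Proof. intros; unfold formula_closed; dfn_auto. Qed.
#[global] Hint Resolve dfn_formula_closed : dfn.

Lemma dfn_is_formula {M : set_model} (L : (nat -> M) -> signature M)
    (p : (nat -> M) -> M) :
  is_arg (fun e => rel_arity (L e)) -> is_arg (fun e => fun_arity (L e)) ->
  is_arg p ->
  dfn (fun e => is_formula (L e) (p e)).
Proof. intros; unfold is_formula; dfn_auto. Qed.
#[global] Hint Resolve dfn_is_formula : dfn.

Lemma dfn_elementary {M : set_model} (L : (nat -> M) -> signature M)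
    (A : (nat -> M) -> structure M) (B : (nat -> M) -> structure M)
    (j : (nat -> M) -> M) :
  is_arg (fun e => rel_arity (L e)) -> is_arg (fun e => fun_arity (L e)) ->
  is_arg (fun e => univ (A e)) -> is_arg (fun e => rels (A e)) ->
  is_arg (fun e => funs (A e)) -> is_arg (fun e => univ (B e)) ->
  is_arg (fun e => rels (B e)) -> is_arg (fun e => funs (B e)) -> is_arg j ->
  dfn (fun e => elementary (L e) (A e) (B e) (j e)).
Proof. intros; unfold elementary; dfn_auto. Qed.
#[global] Hint Resolve dfn_elementary : dfn.

Lemma dfn_set_signature {M : set_model} (L : (nat -> M) -> signature M) :
  is_arg (fun e => rel_arity (L e)) -> is_arg (fun e => fun_arity (L e)) ->
  dfn (fun e => set_signature (L e)).
Proof. intros; unfold set_signature; dfn_auto. Qed.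
#[global] Hint Resolve dfn_set_signature : dfn.

Lemma dfn_is_mem_relation {M : set_model} (v : (nat -> M) -> M)
    (R : (nat -> M) -> M) :
  is_arg v -> is_arg R ->
  dfn (fun e => is_mem_relation (v e) (R e)).
Proof. intros; unfold is_mem_relation; dfn_auto. Qed.
#[global] Hint Resolve dfn_is_mem_relation : dfn.

Lemma dfn_is_mem_structure {M : set_model} (v : (nat -> M) -> M)
    (A : (nat -> M) -> structure M) :
  is_arg v -> is_arg (fun e => univ (A e)) -> is_arg (fun e => rels (A e)) ->
  is_arg (fun e => funs (A e)) ->
  dfn (fun e => is_mem_structure (v e) (A e)).
Proof. intros; unfold is_mem_structure; dfn_auto. Qed.
#[global] Hint Resolve dfn_is_mem_structure : dfn.

Lemma dfn_rank_embedding {M : set_model} (l : (nat -> M) -> M)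
    (j : (nat -> M) -> M) :
  is_arg l -> is_arg j ->
  dfn (fun e => rank_embedding (l e) (j e)).
Proof. intros; unfold rank_embedding; dfn_auto. Qed.
#[global] Hint Resolve dfn_rank_embedding : dfn.

Lemma dfn_is_crit {M : set_model} (j : (nat -> M) -> M) (k : (nat -> M) -> M) :
  is_arg j -> is_arg k ->
  dfn (fun e => is_crit (j e) (k e)).
Proof. intros; unfold is_crit; dfn_auto. Qed.
#[global] Hint Resolve dfn_is_crit : dfn.

Existing Class ZF.

(** * Set theory in a model of ZF *)

Section SetTheory.

Context {M : set_model} {hZF : ZF M}.
Implicit Types (a b c x y z : M).

Lemma ext x y : (forall z, z ∈ x <-> z ∈ y) -> x = y.
Proof. exact (@ZF_extensionality M hZF x y). Qed.

(** Choice is applied outside the model only, to turn existence axioms into operations on the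
    carrier. This gives no choice function in the model, and the operations never enter an external
    formula except through their values. *)
Definition the (P : M -> Prop) (H : exists x, P x) : M :=
  proj1_sig (constructive_indefinite_description P H).

Lemma theP (P : M -> Prop) (H : exists x, P x) : P (the H).
Proof. exact (proj2_sig (constructive_indefinite_description P H)). Qed.

Lemma empty_exists : exists z : M, is_empty z.
Proof. destruct (ZF_infinity hZF) as [w [[z [Hz _]] _]]; eauto. Qed.

Definition emp : M := the empty_exists.

Lemma not_mem_emp z : ~ z ∈ emp.
Proof. exact (theP empty_exists z). Qed.

Lemma is_emptyE z : is_empty z <-> z = emp.
Proof.
split; [|intros ->; exact not_mem_emp].
intro H; apply ext; intro y; split; intro Hy.
- destruct (H y Hy).
- destruct (not_mem_emp Hy).
Qed.

Definition up a b : M := the (ZF_pairing hZF a b).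

Lemma mem_up a b z : z ∈ up a b <-> z = a \/ z = b.
Proof. exact (theP (ZF_pairing hZF a b) z). Qed.

Lemma is_pairE a b p : is_pair a b p <-> p = up a b.
Proof.
split.
- intro H; apply ext; intro z; rewrite mem_up; apply H.
- intros ->; intro z; apply mem_up.
Qed.

Definition op a b : M := up (up a a) (up a b).

Lemma is_opairE a b p : is_opair a b p <-> p = op a b.
Proof.
split.
- intros [u [v [Hu [Hv Hp]]]]; rewrite !is_pairE in *; subst; reflexivity.
- intros ->; exists (up a a), (up a b); rewrite !is_pairE; auto.
Qed.

Lemma up_inj a b c d : up a b = up c d -> (a = c /\ b = d) \/ (a = d /\ b = c).
Proof.
intro H.
assert (forall z, z = a \/ z = b <-> z = c \/ z = d) as E
  by (intro z; rewrite <- !mem_up, H; tauto).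
generalize (proj1 (E a) (or_introl eq_refl)),
  (proj1 (E b) (or_intror eq_refl)), (proj2 (E c) (or_introl eq_refl)),
  (proj2 (E d) (or_intror eq_refl)).
intuition congruence.
Qed.

Lemma op_inj a b c d : op a b = op c d -> a = c /\ b = d.
Proof.
unfold op; intro H; apply up_inj in H as [[H1 H2]|[H1 H2]];
apply up_inj in H1; apply up_inj in H2; intuition congruence.
Qed.

Definition un a : M := the (ZF_union hZF a).

Lemma mem_un a x : x ∈ un a <-> exists y, y ∈ a /\ x ∈ y.
Proof. exact (theP (ZF_union hZF a) x). Qed.

Definition pw a : M := the (ZF_powerset hZF a).

Lemma mem_pw a x : x ∈ pw a <-> subset x a.
Proof. exact (theP (ZF_powerset hZF a) x). Qed.

Definition cup a b : M := un (up a b).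

Lemma mem_cup a b x : x ∈ cup a b <-> x ∈ a \/ x ∈ b.
Proof.
unfold cup; rewrite mem_un; split.
- intros [y [Hy Hx]]; apply mem_up in Hy as [->| ->]; auto.
- intros [H|H]; [exists a | exists b]; rewrite mem_up; auto.
Qed.

Definition sc a : M := cup a (up a a).

Lemma mem_sc a x : x ∈ sc a <-> x ∈ a \/ x = a.
Proof. unfold sc; rewrite mem_cup, mem_up; tauto. Qed.

Lemma is_succE a s : is_succ a s <-> s = sc a.
Proof.
split.
- intro H; apply ext; intro z; rewrite mem_sc; apply H.
- intros ->; intro z; apply mem_sc.
Qed.

Lemma sep_exists (P : M -> Prop) : dfn1 P ->
  forall a, exists b, forall x, x ∈ b <-> x ∈ a /\ P x.
Proof.
intros HP a; apply (ZF_separation hZF), (definable_dfn a); dfn_auto.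
Qed.

Lemma repl_exists (R : M -> M -> Prop) : dfn2 R ->
  forall a, (forall x y y', x ∈ a -> R x y -> R x y' -> y = y') ->
  exists b, forall y, y ∈ b <-> exists x, x ∈ a /\ R x y.
Proof.
intros HR a H; apply (ZF_replacement hZF); eauto.
apply (definable2_dfn a); dfn_auto.
Qed.

Lemma not_mem_self x : ~ x ∈ x.
Proof.
intro H.
destruct (ZF_foundation hZF (x := up x x)) as [y [Hy Hz]].
- exists x; apply mem_up; auto.
- apply mem_up in Hy; assert (y = x) as -> by tauto.
  apply (Hz x); [apply mem_up; auto | exact H].
Qed.

Lemma not_mem_cycle3 x y z : x ∈ y -> y ∈ z -> z ∈ x -> False.
Proof.
intros Hxy Hyz Hzx.
destruct (ZF_foundation hZF (x := cup (up x y) (up z z))) as [t [Ht Hmin]].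
- exists x; rewrite mem_cup, !mem_up; auto.
- assert (forall s, s = x \/ s = y \/ s = z -> ~ s ∈ t) as Hs
    by (intros s ?; apply Hmin; rewrite mem_cup, !mem_up; tauto).
  rewrite mem_cup, !mem_up in Ht.
  destruct Ht as [[->| ->]|[->| ->]]; [apply (Hs z)|apply (Hs x)| |];
  try apply (Hs y); auto.
Qed.

Lemma not_mem_cycle2 x y : x ∈ y -> y ∈ x -> False.
Proof.
intros Hxy Hyx.
destruct (ZF_foundation hZF (x := up x y)) as [t [Ht Hmin]].
- exists x; rewrite mem_up; auto.
- assert (forall s, s = x \/ s = y -> ~ s ∈ t) as Hs
    by (intros s ?; apply Hmin; rewrite mem_up; tauto).
  rewrite mem_up in Ht.
  destruct Ht as [->| ->]; [apply (Hs y)|apply (Hs x)]; auto.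
Qed.

Lemma ordinal_mem a b : ordinal a -> b ∈ a -> ordinal b.
Proof.
intros [Ta Ha] Hb; split.
- intros y Hy z Hz.
  destruct (Ha z b) as [H|[->|H]]; auto.
  + exact (Ta y (Ta b Hb y Hy) z Hz).
  + destruct (not_mem_cycle2 Hz Hy).
  + destruct (not_mem_cycle3 Hz Hy H).
- intros y z Hy Hz; apply Ha; apply (Ta b Hb); assumption.
Qed.

Lemma ordinal_trans a b c : ordinal a -> b ∈ a -> c ∈ b -> c ∈ a.
Proof. intros [T _] Hb Hc; exact (T b Hb c Hc). Qed.

(** A minimal element of the difference of [b] and [a], provided by foundation, turns out to be [a]
    itself. *)
Lemma ordinal_subset_mem a b :
  ordinal a -> ordinal b -> subset a b -> a <> b -> a ∈ b.
Proof.
intros Ha Hb Hab Hne.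
destruct (@sep_exists (fun x => ~ x ∈ a)) with (a := b) as [d Hd];
  [dfn_auto|].
destruct (ZF_foundation hZF (x := d)) as [c [Hc Hmin]].
- apply NNPP; intro F; apply Hne, ext; intro z; split; [apply Hab|].
  intro Hz; apply NNPP; intro G; apply F; exists z; apply Hd; auto.
- apply Hd in Hc as [Hcb Hca].
  assert (a = c) as ->; [|assumption].
  apply ext; intro x; split; intro Hx.
  + destruct (proj2 Hb x c) as [H|[H|H]]; auto.
    * subst; tauto.
    * destruct Hca; exact (ordinal_trans Ha Hx H).
  + apply NNPP; intro G; apply (Hmin x); [|assumption].
    apply Hd; split; [exact (ordinal_trans Hb Hcb Hx) | exact G].
Qed.

(** The intersection of [a] and [b] is an ordinal. If it were different from both, it would be an
    element of both and hence of itself. *)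
Lemma ordinal_trichotomy a b :
  ordinal a -> ordinal b -> a ∈ b \/ a = b \/ b ∈ a.
Proof.
intros Ha Hb.
destruct (@sep_exists (fun x => x ∈ b)) with (a := a) as [d Hd]; [dfn_auto|].
assert (ordinal d) as Od.
{ split.
  - intros y Hy z Hz; apply Hd in Hy as [H1 H2]; apply Hd; split;
      eauto using ordinal_trans.
  - intros y z Hy Hz; apply Hd in Hy; apply Hd in Hz; apply Ha; tauto. }
destruct (classic (d = a)) as [->|Hda].
- destruct (classic (a = b)) as [->|Hab]; auto.
  left; apply ordinal_subset_mem; auto; intros z Hz; apply Hd in Hz; tauto.
- destruct (classic (d = b)) as [->|Hdb].
  + right; right; apply ordinal_subset_mem; auto; intros z Hz.
    apply Hd in Hz; tauto.
  + destruct (@not_mem_self d); apply Hd; split;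
    apply ordinal_subset_mem; auto; intros z Hz; apply Hd in Hz; tauto.
Qed.

Lemma ordinal_not_mem a b :
  ordinal a -> ordinal b -> ~ a ∈ b -> b = a \/ b ∈ a.
Proof. intros Ha Hb H; destruct (ordinal_trichotomy Ha Hb); intuition. Qed.

Lemma ordinal_least (P : M -> Prop) : dfn1 P ->
  (exists a, ordinal a /\ P a) ->
  exists a, ordinal a /\ P a /\ forall b, b ∈ a -> ~ P b.
Proof.
intros HP [a [Ha Pa]].
destruct (@sep_exists P HP (sc a)) as [d Hd].
destruct (ZF_foundation hZF (x := d)) as [c [Hc Hmin]].
- exists a; apply Hd; rewrite mem_sc; auto.
- apply Hd in Hc as [Hca Pc].
  assert (ordinal c) as Oc.
  { apply mem_sc in Hca as [Hca| ->]; eauto using ordinal_mem. }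
  exists c; split; [|split]; auto.
  intros b Hb Pb; apply (Hmin b); auto.
  apply Hd; split; auto.
  apply mem_sc in Hca as [Hca| ->]; apply mem_sc; auto.
  left; exact (ordinal_trans Ha Hca Hb).
Qed.

(** Seen from outside, the ordinals of the model need not be well-ordered, so a least counterexample
    is available only for classes that Separation can cut out. *)
Lemma ordinal_ind (P : M -> Prop) : dfn1 P ->
  (forall a, ordinal a -> (forall b, b ∈ a -> P b) -> P a) ->
  forall a, ordinal a -> P a.
Proof.
intros HP IH a Ha; apply NNPP; intro F.
destruct (@ordinal_least (fun x => ~ P x)) as [b [Ob [Pb Hb]]].
- dfn_auto.
- eauto.
- apply Pb, IH; auto; intros c Hc; apply NNPP; exact (Hb c Hc).
Qed.

Lemma ordinal_emp : ordinal emp.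
Proof. split; intros y; intros; edestruct not_mem_emp; eassumption. Qed.

Lemma ordinal_sc a : ordinal a -> ordinal (sc a).
Proof.
intro Ha; split.
- intros y Hy z Hz; apply mem_sc in Hy as [Hy| ->]; apply mem_sc; auto.
  left; exact (ordinal_trans Ha Hy Hz).
- intros y z Hy Hz; apply mem_sc in Hy; apply mem_sc in Hz.
  destruct Hy as [Hy| ->], Hz as [Hz| ->]; auto; apply (proj2 Ha); auto.
Qed.

Lemma ordinal_un x : (forall a, a ∈ x -> ordinal a) -> ordinal (un x).
Proof.
intro H; split.
- intros y Hy z Hz; apply mem_un in Hy as [a [Ha Hy]].
  apply mem_un; exists a; split; auto; exact (ordinal_trans (H a Ha) Hy Hz).
- intros y z Hy Hz.
  apply mem_un in Hy as [a [Ha Hy]]; apply mem_un in Hz as [b [Hb Hz]].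
  apply ordinal_trichotomy;
    [exact (ordinal_mem (H a Ha) Hy) | exact (ordinal_mem (H b Hb) Hz)].
Qed.

Lemma ordinal_sc_le a b : ordinal b -> a ∈ b -> sc a ∈ b \/ sc a = b.
Proof.
intros Hb Hab.
destruct (@ordinal_trichotomy (sc a) b) as [H|[H|H]]; auto.
- apply ordinal_sc; eapply ordinal_mem; eauto.
- apply mem_sc in H as [H| ->]; [|destruct (not_mem_self Hab)].
  destruct (not_mem_cycle2 H Hab).
Qed.

Lemma sc_inj a b : sc a = sc b -> a = b.
Proof.
intro H.
assert (a ∈ sc b) as Ha by (rewrite <- H; apply mem_sc; auto).
assert (b ∈ sc a) as Hb by (rewrite H; apply mem_sc; auto).
apply mem_sc in Ha; apply mem_sc in Hb.
destruct Ha as [Ha|Ha], Hb as [Hb|Hb]; auto.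
destruct (not_mem_cycle2 Ha Hb).
Qed.

Lemma sc_neq_emp a : sc a <> emp.
Proof. intro H; apply (@not_mem_emp a); rewrite <- H; apply mem_sc; auto. Qed.

Lemma inductiveE w :
  inductive w <-> emp ∈ w /\ forall n, n ∈ w -> sc n ∈ w.
Proof.
split.
- intros [H0 HS]; split; [apply H0, is_emptyE; reflexivity|].
  intros n Hn; apply (HS n); auto; apply is_succE; reflexivity.
- intros [H0 HS]; split.
  + intros z Hz; apply is_emptyE in Hz; subst; auto.
  + intros n s Hn Hs; apply is_succE in Hs; subst; auto.
Qed.

Lemma omega_exists : exists w : M, is_omega w.
Proof.
destruct (ZF_infinity hZF) as [w [[z [Hz Hzw]] HS]].
destruct (@sep_exists (fun x => forall z, inductive z -> x ∈ z)) with (a := w)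
  as [o Ho]; [dfn_auto|].
assert (inductive w) as Hw.
{ apply inductiveE; split.
  - apply is_emptyE in Hz; subst; auto.
  - intros n Hn; destruct (HS n Hn) as [s [Hs Hsw]].
    apply is_succE in Hs; subst; auto. }
exists o; split.
- apply inductiveE; split; [|intros n Hn]; apply Ho.
  + split; [exact (proj1 (proj1 (inductiveE _) Hw))|].
    intros y Hy; exact (proj1 (proj1 (inductiveE _) Hy)).
  + apply Ho in Hn as [Hn Hy]; split.
    * exact (proj2 (proj1 (inductiveE _) Hw) n Hn).
    * intros y Iy; exact (proj2 (proj1 (inductiveE _) Iy) n (Hy y Iy)).
- intros y Hy x Hx; apply Ho in Hx as [_ Hx]; auto.
Qed.

Definition om : M := the omega_exists.

Lemma is_omegaE w : is_omega w <-> w = om.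
Proof.
assert (is_omega om) as H by apply (theP omega_exists).
split; [|intros ->; auto].
intros [Iw Mw]; destruct H as [Io Mo].
apply ext; intro z; split; [apply Mw; auto | apply Mo; auto].
Qed.

Lemma naturalE n : natural n <-> n ∈ om.
Proof.
split.
- intros [w [Hw Hn]]; apply is_omegaE in Hw; subst; auto.
- intro H; exists om; split; auto; apply is_omegaE; reflexivity.
Qed.

Lemma emp_om : emp ∈ om.
Proof.
assert (is_omega om) as [H _] by (apply is_omegaE; reflexivity).
exact (proj1 (proj1 (inductiveE _) H)).
Qed.

Lemma sc_om n : n ∈ om -> sc n ∈ om.
Proof.
assert (is_omega om) as [H _] by (apply is_omegaE; reflexivity).
exact (proj2 (proj1 (inductiveE _) H) n).
Qed.

Lemma om_ind (P : M -> Prop) : dfn1 P -> P emp ->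
  (forall n, n ∈ om -> P n -> P (sc n)) -> forall n, n ∈ om -> P n.
Proof.
intros HP H0 HS n Hn.
destruct (@sep_exists P HP om) as [d Hd].
assert (is_omega om) as [_ H] by (apply is_omegaE; reflexivity).
apply (Hd n), (H d); auto.
apply inductiveE; split.
- apply Hd; split; auto; exact emp_om.
- intros m Hm; apply Hd in Hm as [Hm Pm]; apply Hd; split; auto.
  apply sc_om; auto.
Qed.

Lemma om_cases n : n ∈ om -> n = emp \/ exists m, m ∈ om /\ n = sc m.
Proof.
intro Hn.
assert (n = emp \/ exists m, m ∈ om /\ is_succ m n) as H.
{ revert n Hn; apply om_ind; [dfn_auto|auto|].
  intros n Hn _; right; exists n; split; auto; apply is_succE; auto. }
destruct H as [H|[m [Hm H]]]; auto.
right; exists m; split; auto; apply is_succE; auto.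
Qed.

Lemma ordinal_om : ordinal om.
Proof.
split.
- assert (forall n, n ∈ om -> subset n om) as H.
  { apply om_ind; [dfn_auto| |].
    - intros z Hz; destruct (not_mem_emp Hz).
    - intros n Hn IH z Hz; apply mem_sc in Hz as [Hz| ->]; auto. }
  exact H.
- assert (forall n, n ∈ om -> ordinal n) as H.
  { apply om_ind; [dfn_auto| |].
    - exact ordinal_emp.
    - intros n _; apply ordinal_sc. }
  intros y z Hy Hz; apply ordinal_trichotomy; auto.
Qed.

Lemma ordinal_nat n : n ∈ om -> ordinal n.
Proof. exact (ordinal_mem ordinal_om). Qed.

Fixpoint num (k : nat) : M :=
  match k with 0 => emp | S k => sc (num k) end.

Lemma is_numeralE k x : is_numeral k x <-> x = num k.
Proof.
revert x; induction k as [|k IH]; intro x; simpl; [apply is_emptyE|].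
split.
- intros [y [Hy Hx]]; apply IH in Hy; apply is_succE in Hx; subst; auto.
- intros ->; exists (num k); split; [apply IH|apply is_succE]; auto.
Qed.

Lemma num_om k : num k ∈ om.
Proof. induction k; simpl; [exact emp_om | apply sc_om; auto]. Qed.

Lemma num_inj k l : num k = num l -> k = l.
Proof.
revert l; induction k as [|k IH]; intros [|l]; simpl; intro H; auto.
- destruct (sc_neq_emp (eq_sym H)).
- destruct (sc_neq_emp H).
- f_equal; apply IH, sc_inj, H.
Qed.

Lemma pair_inE x y f : pair_in x y f <-> op x y ∈ f.
Proof.
split.
- intros [p [Hp Hf]]; apply is_opairE in Hp; subst; auto.
- intro H; exists (op x y); split; auto; apply is_opairE; auto.
Qed.

Lemma mapsE f x y : maps f x y <-> op x y ∈ f.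
Proof. apply pair_inE. Qed.

Lemma is_funE f X Y : is_fun f X Y <->
  (forall p, p ∈ f -> exists x y, x ∈ X /\ y ∈ Y /\ p = op x y) /\
  (forall x, x ∈ X -> exists y, y ∈ Y /\ maps f x y) /\
  (forall x y y', maps f x y -> maps f x y' -> y = y').
Proof.
split.
- intros [H1 H2]; split; [|split].
  + intros p Hp; destruct (H1 p Hp) as [x [y [Hx [Hy Hxy]]]].
    exists x, y; rewrite <- is_opairE; auto.
  + intros x Hx; destruct (H2 x Hx) as [y [Hy _]]; exists y; split; auto.
    rewrite mapsE in Hy; destruct (H1 _ Hy) as [x' [y' [Hx' [Hy' E]]]].
    apply is_opairE, op_inj in E as [-> ->]; auto.
  + intros x y y' Hy Hy'.
    assert (x ∈ X) as Hx.
    { rewrite mapsE in Hy; destruct (H1 _ Hy) as [x' [z [Hx' [_ E]]]].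
      apply is_opairE, op_inj in E as [-> ->]; auto. }
    destruct (H2 x Hx) as [z [_ Hz]].
    rewrite <- (Hz y Hy); apply Hz; auto.
- intros [H1 [H2 H3]]; split.
  + intros p Hp; destruct (H1 p Hp) as [x [y [Hx [Hy Hxy]]]].
    exists x, y; rewrite is_opairE; auto.
  + intros x Hx; destruct (H2 x Hx) as [y [Hy Hxy]].
    exists y; split; auto; intros z Hz; eapply H3; eauto.
Qed.

Lemma fun_functional f X Y x y y' :
  is_fun f X Y -> maps f x y -> maps f x y' -> y = y'.
Proof. intros H; apply is_funE in H; destruct H as [_ [_ H]]; apply H. Qed.

Lemma fun_total f X Y x :
  is_fun f X Y -> x ∈ X -> exists y, y ∈ Y /\ maps f x y.
Proof. intros H; apply is_funE in H; destruct H as [_ [H _]]; apply H. Qed.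

Lemma fun_mem f X Y x y : is_fun f X Y -> maps f x y -> x ∈ X /\ y ∈ Y.
Proof.
intros H Hxy; apply is_funE in H; destruct H as [H _].
apply mapsE in Hxy; destruct (H _ Hxy) as [x' [y' [Hx [Hy E]]]].
apply op_inj in E as [-> ->]; auto.
Qed.

Lemma fun_ext f g X Y Y' : is_fun f X Y -> is_fun g X Y' ->
  (forall x y, x ∈ X -> maps f x y -> maps g x y) -> f = g.
Proof.
intros Hf Hg H.
assert (forall x y, maps f x y -> maps g x y) as H'.
{ intros x y Hxy; apply H; auto; apply (fun_mem Hf Hxy). }
apply ext; intro p; split; intro Hp.
- destruct (proj1 (proj1 (is_funE _ _ _) Hf) p Hp) as [x [y [_ [_ ->]]]].
  apply mapsE, H', mapsE, Hp.
- destruct (proj1 (proj1 (is_funE _ _ _) Hg) p Hp) as [x [y [Hx [_ ->]]]].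
  destruct (fun_total Hf Hx) as [y' [_ Hy']].
  rewrite (fun_functional Hg (proj2 (mapsE _ _ _) Hp) (H' _ _ Hy')).
  apply mapsE, Hy'.
Qed.

Lemma prod_exists X Y :
  exists P, forall p, p ∈ P <-> exists x y, x ∈ X /\ y ∈ Y /\ p = op x y.
Proof.
destruct (@sep_exists (fun p => exists x y, x ∈ X /\ y ∈ Y /\ is_opair x y p))
  with (a := pw (pw (cup X Y))) as [P HP]; [dfn_auto|].
exists P; intro p; rewrite HP; split.
- intros [_ [x [y [Hx [Hy H]]]]]; apply is_opairE in H; eauto.
- intros [x [y [Hx [Hy ->]]]]; split.
  + apply mem_pw; intros z Hz; apply mem_pw; intros t Ht.
    apply mem_cup; unfold op in Hz; apply mem_up in Hz.
    destruct Hz as [->| ->]; apply mem_up in Ht as [->| ->]; auto.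
  + exists x, y; rewrite is_opairE; auto.
Qed.

Definition prod X Y : M := the (prod_exists X Y).

Lemma mem_prod X Y p :
  p ∈ prod X Y <-> exists x y, x ∈ X /\ y ∈ Y /\ p = op x y.
Proof. exact (theP (prod_exists X Y) p). Qed.

Lemma fun_subset_prod f X Y : is_fun f X Y -> subset f (prod X Y).
Proof.
intros H p Hp; apply mem_prod; apply is_funE in H; destruct H as [H _]; auto.
Qed.

Lemma fun_exists (R : M -> M -> Prop) X Y : dfn2 R ->
  (forall x, x ∈ X -> exists y, y ∈ Y /\ R x y) ->
  (forall x y y', x ∈ X -> R x y -> R x y' -> y = y') ->
  exists f, is_fun f X Y /\ forall x y, maps f x y <-> x ∈ X /\ y ∈ Y /\ R x y.
Proof.
intros HR Htot Hfun.
destruct (@sep_exists (fun p => exists x y, is_opair x y p /\ R x y))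
  with (a := prod X Y) as [f Hf]; [dfn_auto|].
assert (forall x y, maps f x y <-> x ∈ X /\ y ∈ Y /\ R x y) as Hm.
{ intros x y; rewrite mapsE, Hf, mem_prod; split.
  - intros [[x' [y' [Hx [Hy E]]]] [x'' [y'' [E' HR']]]].
    apply is_opairE in E'.
    apply op_inj in E as [-> ->]; apply op_inj in E' as [-> ->]; auto.
  - intros [Hx [Hy H]]; split; eauto 6.
    exists x, y; rewrite is_opairE; auto. }
exists f; split; auto.
apply is_funE; split; [|split].
- intros p Hp; apply Hf in Hp as [Hp _]; apply mem_prod, Hp.
- intros x Hx; destruct (Htot x Hx) as [y [Hy H]]; exists y; split; auto.
  apply Hm; auto.
- intros x y y' H H'; apply Hm in H; apply Hm in H'.
  eapply Hfun; [apply H|apply H|apply H'].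
Qed.

End SetTheory.

(** * The cumulative hierarchy *)

Section Hierarchy.

Context {M : set_model} {hZF : ZF M}.
Implicit Types (a b c x y z : M).

Definition V_function (a f : M) : Prop :=
  ordinal a /\ is_fun_on f (sc a) /\
  (forall b u, maps f b u ->
     forall x, x ∈ u <-> exists c w, c ∈ b /\ maps f c w /\ subset x w).

Lemma is_VE a v : is_V a v <-> exists f, V_function a f /\ maps f a v.
Proof.
split.
- intros [Ha [s [f [Hs [Hf [Hr Hm]]]]]]; apply is_succE in Hs; subst s.
  exists f; split; [split|]; auto.
- intros [f [[Ha [Hf Hr]] Hm]]; split; auto; exists (sc a), f.
  rewrite is_succE; auto.
Qed.

Lemma V_function_unique a b f g : V_function a f -> V_function b g ->
  forall c, ordinal c -> forall u v, maps f c u -> maps g c v -> u = v.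
Proof.
intros [Ha [[Y Hf] Fr]] [Hb [[Z Hg] Gr]].
apply (ordinal_ind (P := fun c => forall u v, maps f c u -> maps g c v -> u = v));
  [dfn_auto|].
intros c Hc IH u v Hu Hv.
assert (forall d, d ∈ c -> d ∈ sc a /\ d ∈ sc b) as Hd.
{ intros d Hd; split.
  - apply (ordinal_trans (b := c)); auto; [apply ordinal_sc; auto|].
    apply (fun_mem Hf Hu).
  - apply (ordinal_trans (b := c)); auto; [apply ordinal_sc; auto|].
    apply (fun_mem Hg Hv). }
apply ext; intro x.
rewrite (Fr c u Hu), (Gr c v Hv); split; intros [d [w [Hdc [Hw Hx]]]].
- destruct (fun_total Hg (proj2 (Hd d Hdc))) as [w' [_ Hw']].
  assert (w = w') by exact (IH d Hdc w w' Hw Hw'); subst w'; eauto.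
- destruct (fun_total Hf (proj1 (Hd d Hdc))) as [w' [_ Hw']].
  assert (w' = w) by exact (IH d Hdc w' w Hw' Hw); subst w'; eauto.
Qed.

Lemma is_V_unique a u v : is_V a u -> is_V a v -> u = v.
Proof.
rewrite !is_VE; intros [f [Hf Hu]] [g [Hg Hv]].
exact (V_function_unique Hf Hg (proj1 Hf) Hu Hv).
Qed.

(** The restriction of [f] to [sc b] is itself a witness for stage [b]. *)
Lemma V_function_mem a f b u : V_function a f -> maps f b u -> is_V b u.
Proof.
intros [Ha [[Y Hf] Fr]] Hu.
assert (b ∈ sc a) as Hba by apply (fun_mem Hf Hu).
assert (ordinal b) as Hb by exact (ordinal_mem (ordinal_sc Ha) Hba).
assert (forall c, c ∈ sc b -> c ∈ sc a) as Hc.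
{ intros c Hc; apply mem_sc in Hc as [Hc| ->]; auto.
  exact (ordinal_trans (ordinal_sc Ha) Hba Hc). }
destruct (@fun_exists M hZF (fun x y => maps f x y) (sc b) Y) as [g [Hg Gm]];
  [dfn_auto| | |].
{ intros x Hx; exact (fun_total Hf (Hc x Hx)). }
{ intros x y y' _ Hy Hy'; exact (fun_functional Hf Hy Hy'). }
apply is_VE; exists g; split.
- split; [|split]; auto.
  + exists Y; auto.
  + intros c w Hw x; apply Gm in Hw as [Hcb [_ Hw]].
    rewrite (Fr c w Hw x); split; intros [d [w' [Hd [Hw' Hx]]]];
      exists d, w'; split; auto; split; auto.
    * apply Gm; split; [|split]; auto.
      -- apply mem_sc in Hcb as [Hcb| ->]; apply mem_sc; left; auto.
         exact (ordinal_trans Hb Hcb Hd).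
      -- apply (fun_mem Hf Hw').
    * apply Gm in Hw'; tauto.
- apply Gm; split; [|split]; auto.
  + apply mem_sc; auto.
  + apply (fun_mem Hf Hu).
Qed.

Lemma is_V_exists a : ordinal a -> exists v, is_V a v.
Proof.
revert a; apply ordinal_ind; [dfn_auto|].
intros a Ha IH.
destruct (@repl_exists M hZF (fun b v => is_V b v)) with (a := a) as [W HW];
  [dfn_auto|intros x y y' _; apply is_V_unique|].
destruct (@sep_exists M hZF (fun x => exists c w, c ∈ a /\ is_V c w /\ subset x w))
  with (a := pw (un W)) as [v Hv]; [dfn_auto|].
assert (forall x, x ∈ v <-> exists c w, c ∈ a /\ is_V c w /\ subset x w) as Hv'.
{ intro x; rewrite Hv; split; [tauto|intro H; split; auto].
  destruct H as [c [w [Hc [Hw Hx]]]]; apply mem_pw; intros z Hz.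
  apply mem_un; exists w; split; auto; apply HW; eauto. }
(* The witness for [a] is assembled from the stages V_b themselves, which are unique, so that no
   witnessing functions for the earlier stages have to be selected. *)
destruct (@fun_exists M hZF
  (fun b u => (b ∈ a /\ is_V b u) \/ (b = a /\ u = v)) (sc a) (cup W (up v v)))
  as [f [Hf Hm]]; [dfn_auto| | |].
{ intros x Hx; apply mem_sc in Hx as [Hx| ->].
  - destruct (IH x Hx) as [u Hu]; exists u; split; auto.
    apply mem_cup; left; apply HW; eauto.
  - exists v; rewrite mem_cup, mem_up; auto. }
{ intros x y y' _ [[Hx Hy]|[Hx Hy]] [[Hx' Hy']|[Hx' Hy']]; subst; auto.
  - exact (is_V_unique Hy Hy').
  - destruct (not_mem_self Hx).
  - destruct (not_mem_self Hx'). }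
assert (forall b u, maps f b u <-> (b ∈ a /\ is_V b u) \/ (b = a /\ u = v)) as Hm'.
{ intros b u; rewrite Hm, mem_sc, mem_cup, mem_up, HW; split; [tauto|].
  intros [[Hb Hu]|[-> ->]]; split; auto; split; auto.
  left; eauto. }
exists v; apply is_VE; exists f; split; [split; [|split]|]; auto.
- exists (cup W (up v v)); auto.
- intros b u Hu x; apply Hm' in Hu as [[Hb Hu]|[-> ->]].
  + apply is_VE in Hu as [g [Hg Hu]].
    assert (Hg' := Hg); destruct Hg' as [_ [[Y Gf] Gr]].
    rewrite (Gr b u Hu); split; intros [c [w [Hc [Hw Hx]]]]; exists c, w;
      split; auto; split; auto.
    * apply Hm'; left; split; [exact (ordinal_trans Ha Hb Hc)|].
      exact (V_function_mem Hg Hw).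
    * apply Hm' in Hw as [[_ Hw]|[-> ->]].
      -- assert (c ∈ sc b) as Hcb by (apply mem_sc; auto).
         destruct (fun_total Gf Hcb) as [w' [_ Hw']].
         rewrite (is_V_unique Hw (V_function_mem Hg Hw')); auto.
      -- destruct (not_mem_cycle2 Hb Hc).
  + rewrite Hv'; split; intros [c [w [Hc [Hw Hx]]]]; exists c, w;
      split; auto; split; auto.
    * apply Hm'; auto.
    * apply Hm' in Hw as [[_ Hw]|[-> ->]]; auto; destruct (not_mem_self Hc).
- apply Hm'; auto.
Qed.

(** At arguments that are not ordinals the value is an arbitrary element. *)
Definition V (a : M) : M := epsilon (inhabits a) (fun v => is_V a v).

Lemma is_VVE a v : is_V a v <-> ordinal a /\ v = V a.
Proof.
assert (ordinal a -> is_V a (V a)) as H.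
{ intro Ha; unfold V; apply epsilon_spec, is_V_exists, Ha. }
split.
- intro Hv; assert (ordinal a) as Ha by apply Hv.
  split; auto; exact (is_V_unique Hv (H Ha)).
- intros [Ha ->]; auto.
Qed.

Lemma mem_V a x : ordinal a -> (x ∈ V a <-> exists c, c ∈ a /\ subset x (V c)).
Proof.
intro Ha.
assert (is_V a (V a)) as Hv by (apply is_VVE; auto).
apply is_VE in Hv as [f [Hf Hv]].
assert (Hf' := Hf); destruct Hf' as [_ [[Y Ff] Fr]].
rewrite (Fr _ _ Hv); split.
- intros [c [w [Hc [Hw Hx]]]]; exists c; split; auto.
  apply (V_function_mem Hf), is_VVE in Hw as [_ ->]; auto.
- intros [c [Hc Hx]].
  assert (c ∈ sc a) as Hc' by (apply mem_sc; auto).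
  destruct (fun_total Ff Hc') as [w [_ Hw]]; exists c, w; split; [|split]; auto.
  apply (V_function_mem Hf), is_VVE in Hw as [_ ->]; auto.
Qed.

Lemma V_mono a b : ordinal b -> a ∈ b -> subset (V a) (V b).
Proof.
intros Hb Hab x Hx; apply mem_V in Hx as [c [Hc Hx]];
  [|exact (ordinal_mem Hb Hab)].
apply mem_V; auto; exists c; split; auto; exact (ordinal_trans Hb Hab Hc).
Qed.

Lemma V_transitive a x y : ordinal a -> x ∈ V a -> y ∈ x -> y ∈ V a.
Proof.
intros Ha Hx Hy; apply mem_V in Hx as [c [Hc Hx]]; auto.
exact (V_mono Ha Hc (Hx y Hy)).
Qed.

Lemma V_subset a x y : ordinal a -> x ∈ V a -> subset y x -> y ∈ V a.
Proof.
intros Ha Hx Hy; apply mem_V in Hx as [c [Hc Hx]]; auto.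
apply mem_V; auto; exists c; split; auto; intros z Hz; auto.
Qed.

Lemma V_mem a b : ordinal b -> a ∈ b -> V a ∈ V b.
Proof. intros Hb Hab; apply mem_V; auto; exists a; split; auto; intros z; auto. Qed.

Lemma ordinal_subset_V a : ordinal a -> forall b, b ∈ a -> b ∈ V a.
Proof.
intros Ha b Hba.
(* The induction is stated with the relation [is_V], because its predicate has to be definable and
   [V] is an external function. *)
assert (forall c, ordinal c -> exists v, is_V c v /\ subset c v) as H.
{ apply ordinal_ind; [dfn_auto|]; intros c Hc IH; exists (V c).
  split; [apply is_VVE; auto|].
  intros d Hd; apply mem_V; auto; exists d; split; auto.
  destruct (IH d Hd) as [v [Hv Hdv]]; apply is_VVE in Hv as [_ ->]; auto. }
destruct (H a Ha) as [v [Hv Hav]]; apply is_VVE in Hv as [_ ->]; auto.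
Qed.

(** * Limit ordinals and the closure of their stages *)

Definition limit (a : M) : Prop :=
  ordinal a /\ emp ∈ a /\ forall b, b ∈ a -> sc b ∈ a.

Section LimitStage.

Variable h : M.
Hypothesis Hh : limit h.

Let Oh : ordinal h := proj1 Hh.

Lemma V_limit_bound x c : c ∈ h -> subset x (V c) -> x ∈ V h.
Proof. intros Hc Hx; apply mem_V; eauto. Qed.

Lemma V_limit_up x y : x ∈ V h -> y ∈ V h -> up x y ∈ V h.
Proof.
intros Hx Hy.
apply mem_V in Hx as [c [Hc Hx]]; auto; apply mem_V in Hy as [d [Hd Hy]]; auto.
assert (exists e, e ∈ h /\ subset x (V e) /\ subset y (V e)) as [e [He [Hx' Hy']]].
{ assert (ordinal c) as Oc by exact (ordinal_mem Oh Hc).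
  assert (ordinal d) as Od by exact (ordinal_mem Oh Hd).
  destruct (ordinal_trichotomy Oc Od) as [H|[->|H]].
  - exists d; split; [|split]; auto; intros z Hz; exact (V_mono Od H (Hx z Hz)).
  - exists d; auto.
  - exists c; split; [|split]; auto; intros z Hz; exact (V_mono Oc H (Hy z Hz)). }
apply (@V_limit_bound _ (sc e)); [apply Hh, He|].
intros z Hz; apply mem_V; [apply ordinal_sc, (ordinal_mem Oh He)|].
exists e; split; [apply mem_sc; auto|].
apply mem_up in Hz as [->| ->]; auto.
Qed.

Lemma V_limit_op x y : x ∈ V h -> y ∈ V h -> op x y ∈ V h.
Proof. intros; unfold op; apply V_limit_up; apply V_limit_up; auto. Qed.

Lemma V_limit_un x : x ∈ V h -> un x ∈ V h.
Proof.
intro Hx; apply mem_V in Hx as [c [Hc Hx]]; auto.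
apply (V_limit_bound Hc); intros z Hz; apply mem_un in Hz as [y [Hy Hz]].
exact (V_transitive (ordinal_mem Oh Hc) (Hx y Hy) Hz).
Qed.

Lemma V_limit_cup x y : x ∈ V h -> y ∈ V h -> cup x y ∈ V h.
Proof. intros; apply V_limit_un, V_limit_up; auto. Qed.

Lemma V_limit_pw x : x ∈ V h -> pw x ∈ V h.
Proof.
intro Hx; apply mem_V in Hx as [c [Hc Hx]]; auto.
apply (@V_limit_bound _ (sc c)); [apply Hh, Hc|].
intros z Hz; apply mem_pw in Hz.
apply mem_V; [apply ordinal_sc, (ordinal_mem Oh Hc)|].
exists c; split; [apply mem_sc; auto|]; intros t Ht; auto.
Qed.

Lemma V_limit_fun f X Y : is_fun f X Y -> X ∈ V h -> Y ∈ V h -> f ∈ V h.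
Proof.
intros Hf HX HY.
apply (V_subset (x := pw (pw (cup X Y)))); auto.
- apply V_limit_pw, V_limit_pw, V_limit_cup; auto.
- intros p Hp; apply (fun_subset_prod Hf), mem_prod in Hp.
  destruct Hp as [x [y [Hx [Hy ->]]]].
  apply mem_pw; intros z Hz; apply mem_pw; intros t Ht.
  apply mem_cup; unfold op in Hz; apply mem_up in Hz.
  destruct Hz as [->| ->]; apply mem_up in Ht as [->| ->]; auto.
Qed.

Lemma V_limit_om n : n ∈ om -> n ∈ V h.
Proof.
intro Hn; apply ordinal_subset_V; auto.
revert n Hn; apply om_ind; [dfn_auto|apply Hh|intros n _; apply Hh].
Qed.

End LimitStage.

(* Functions on [sc n] enumerating a, a + 1, ..., a + n. *)
Definition succ_chain (a n g : M) : Prop :=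
  is_fun_on g (sc n) /\ maps g emp a /\
  forall m x s, m ∈ n -> maps g m x -> is_succ m s ->
    exists y, is_succ x y /\ maps g s y.

Lemma dfn_succ_chain (a n g : (nat -> M) -> M) :
  is_arg a -> is_arg n -> is_arg g ->
  dfn (fun e => succ_chain (a e) (n e) (g e)).
Proof.
intros Ha Hn Hg.
apply (@dfn_ext M (fun e => (exists s, is_succ (n e) s /\ is_fun_on (g e) s) /\
   (exists z, is_empty z /\ maps (g e) z (a e)) /\
   forall m x s, m ∈ n e -> maps (g e) m x -> is_succ m s ->
    exists y, is_succ x y /\ maps (g e) s y)); [|dfn_auto].
intro e; unfold succ_chain; split; intros [H1 [H2 H3]]; split; auto.
- destruct H1 as [s [Hs H1]]; apply is_succE in Hs; subst; auto.
- split; auto; destruct H2 as [s [Hs H2]]; apply is_emptyE in Hs; subst; auto.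
- exists (sc (n e)); rewrite is_succE; auto.
- split; auto; exists emp; rewrite is_emptyE; auto.
Qed.
Hint Resolve dfn_succ_chain : dfn.

Lemma succ_chain_sc a n g m x : succ_chain a n g ->
  m ∈ n -> maps g m x -> maps g (sc m) (sc x).
Proof.
intros [_ [_ H]] Hm Hx.
destruct (H m x (sc m) Hm Hx) as [y [Hy Hg]]; [apply is_succE; auto|].
apply is_succE in Hy; subst; auto.
Qed.

Lemma succ_chain_unique a n n' g g' :
  n ∈ om -> n' ∈ om -> succ_chain a n g -> succ_chain a n' g' ->
  forall m, m ∈ om -> m ∈ sc n -> m ∈ sc n' ->
  forall x x', maps g m x -> maps g' m x' -> x = x'.
Proof.
intros Hn Hn' Hg Hg'.
assert (Hgf := Hg); assert (Hgf' := Hg').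
destruct Hgf as [[Y Gf] [G0 _]], Hgf' as [[Y' Gf'] [G0' _]].
assert (forall m k, k ∈ om -> m ∈ om -> sc m ∈ sc k -> m ∈ k) as Hsc.
{ intros m k Hk Hm H; apply mem_sc in H as [H|H].
  - apply (ordinal_trans (ordinal_nat Hk) H), mem_sc; auto.
  - rewrite <- H; apply mem_sc; auto. }
apply (om_ind (P := fun m => m ∈ sc n -> m ∈ sc n' ->
  forall x x', maps g m x -> maps g' m x' -> x = x')).
- dfn_auto.
- intros _ _ x x' Hx Hx'.
  rewrite (fun_functional Gf Hx G0), (fun_functional Gf' Hx' G0'); auto.
- intros m Hm IH Hmn Hmn' x x' Hx Hx'.
  apply Hsc in Hmn; auto; apply Hsc in Hmn'; auto.
  assert (m ∈ sc n) as H1 by (apply mem_sc; auto).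
  assert (m ∈ sc n') as H1' by (apply mem_sc; auto).
  destruct (fun_total Gf H1) as [y [_ Hy]].
  destruct (fun_total Gf' H1') as [y' [_ Hy']].
  rewrite (fun_functional Gf Hx (succ_chain_sc Hg Hmn Hy)).
  rewrite (fun_functional Gf' Hx' (succ_chain_sc Hg' Hmn' Hy')).
  rewrite (IH H1 H1' y y' Hy Hy'); auto.
Qed.

Lemma succ_chain_exists a n : n ∈ om ->
  exists g x, succ_chain a n g /\ maps g n x.
Proof.
revert n; apply om_ind; [dfn_auto| |].
- destruct (@fun_exists M hZF (fun x y => y = a) (sc emp) (up a a))
    as [f [Hf Hm]]; [dfn_auto| | |].
  + intros x _; exists a; rewrite mem_up; auto.
  + intros; congruence.
  + assert (maps f emp a) as H.
    { apply Hm; rewrite mem_up, mem_sc; auto. }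
    exists f, a; split; auto; split; [eexists; eauto|split; auto].
    intros m x s Hx; destruct (not_mem_emp Hx).
- intros n Hn [g [x [Hg Hx]]].
  assert (Hg' := Hg); destruct Hg' as [[Y Gf] [G0 _]].
  destruct (@fun_exists M hZF
    (fun m y => (m ∈ sc n /\ maps g m y) \/ (m = sc n /\ y = sc x))
    (sc (sc n)) (cup Y (up (sc x) (sc x)))) as [f [Hf Hm]]; [dfn_auto| | |].
  { intros m Hm; apply mem_sc in Hm as [Hm| ->].
    - destruct (fun_total Gf Hm) as [y [Hy Hmy]]; exists y.
      rewrite mem_cup; auto.
    - exists (sc x); rewrite mem_cup, mem_up; auto. }
  { intros m y y' _ [[Hm Hy]|[Hm Hy]] [[Hm' Hy']|[Hm' Hy']]; subst; auto.
    - exact (fun_functional Gf Hy Hy').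
    - destruct (not_mem_self Hm).
    - destruct (not_mem_self Hm'). }
  assert (forall m y, maps f m y <->
    (m ∈ sc n /\ maps g m y) \/ (m = sc n /\ y = sc x)) as Hm'.
  { intros m y; rewrite Hm, mem_sc, mem_cup, mem_up; split; [tauto|].
    intros [[H1 H2]|[H1 H2]]; subst; auto.
    split; [|split]; auto; left; apply (fun_mem Gf H2). }
  exists f, (sc x); split; [|apply Hm'; auto].
  split; [eexists; eauto|split].
  + apply Hm'; left; split; auto; apply (fun_mem Gf G0).
  + intros m y s Hmn Hy Hs; exists (sc y); split; [apply is_succE; auto|].
    apply is_succE in Hs; subst s; apply Hm'.
    apply Hm' in Hy as [[_ Hy]|[-> ->]]; [|destruct (not_mem_self Hmn)].
    apply mem_sc in Hmn as [Hmn| ->].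
    * left; assert (H := succ_chain_sc Hg Hmn Hy); split; auto.
      apply (fun_mem Gf H).
    * right; rewrite (fun_functional Gf Hy Hx); auto.
Qed.

Lemma limit_above a : ordinal a -> exists h, limit h /\ a ∈ h.
Proof.
intro Ha.
(* [R n x] expresses x = a + n. The limit is the union of these ordinals over all internal natural
   numbers; iterating [sc] externally would reach only the standard ones. *)
set (R := fun n x => n ∈ om /\ exists g, succ_chain a n g /\ maps g n x).
assert (forall n x y, R n x -> R n y -> x = y) as HR.
{ intros n x y [Hn [g [Hg Hx]]] [_ [g' [Hg' Hy]]].
  assert (n ∈ sc n) by (apply mem_sc; auto).
  exact (succ_chain_unique Hn Hn Hg Hg' Hn H H Hx Hy). }
destruct (@repl_exists M hZF R) with (a := om) as [W HW];
  [unfold R; dfn_auto|intros n x y _; apply HR|].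
assert (forall x, x ∈ W <-> exists n, R n x) as HW'.
{ intro x; rewrite HW; split; [intros [n [_ H]]; eauto|].
  intros [n H]; exists n; split; auto; apply H. }
clear HW.
assert (R emp a) as R0.
{ split; [exact emp_om|].
  destruct (@succ_chain_exists a emp emp_om) as [g [x [Hg Hx]]].
  exists g; split; auto; apply Hg. }
assert (forall n x, R n x -> R (sc n) (sc x)) as RS.
{ intros n x H; assert (H' := H); destruct H' as [Hn _].
  destruct (@succ_chain_exists a (sc n) (sc_om Hn)) as [g [y [Hg Hy]]].
  assert (Hg' := Hg); destruct Hg' as [[Y Gf] [G0 _]].
  assert (n ∈ sc n) as Hnn by (apply mem_sc; auto).
  assert (n ∈ sc (sc n)) as Hnn' by (apply mem_sc; auto).
  destruct (fun_total Gf Hnn') as [z [_ Hz]].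
  split; [apply sc_om; auto|exists g; split; auto].
  destruct H as [_ [g' [Hg' Hx]]].
  rewrite (succ_chain_unique Hn (sc_om Hn) Hg' Hg Hn Hnn Hnn' Hx Hz).
  exact (succ_chain_sc Hg Hnn Hz). }
assert (forall n, n ∈ om -> forall x, R n x -> ordinal x) as HO.
{ apply (om_ind (P := fun n => forall x, R n x -> ordinal x)).
  - unfold R; dfn_auto.
  - intros x Hx; rewrite (HR _ _ _ Hx R0); auto.
  - intros n Hn IH x Hx.
    destruct (succ_chain_exists a Hn) as [g [y [Hg Hy]]].
    assert (R n y) as Hny by (split; eauto).
    rewrite (HR _ _ _ Hx (RS _ _ Hny)); apply ordinal_sc; eauto. }
exists (un W).
assert (ordinal (un W)) as OW.
{ apply ordinal_un; intros x Hx; apply HW' in Hx as [n Hx].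
  apply (HO n); auto; apply Hx. }
assert (forall b, b ∈ un W -> sc b ∈ un W) as HS.
{ intros b Hb; apply mem_un in Hb as [x [Hx Hb]].
  apply HW' in Hx as [n Hx].
  assert (ordinal x) as Ox by (apply (HO n); auto; apply Hx).
  apply mem_un; exists (sc x); split; [apply HW'; exists (sc n); auto|].
  apply mem_sc; destruct (ordinal_sc_le Ox Hb); auto. }
assert (a ∈ un W) as HaW.
{ apply mem_un; exists (sc a); split; [|apply mem_sc; auto].
  apply HW'; exists (sc emp); auto. }
split; auto; split; [|split]; auto.
destruct (ordinal_trichotomy ordinal_emp OW) as [H|[H|H]]; auto.
- rewrite <- H in HaW; destruct (not_mem_emp HaW).
- destruct (not_mem_emp H).
Qed.

End Hierarchy.

(** * Atomic formulas and Vopenka's principle *)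

Section AtomicFormulas.

Context {M : set_model} {hZF : ZF M}.
Implicit Types (a b c x y z : M).

Lemma tagE k x c : tag k x c <-> c = op (num k) x.
Proof.
split.
- intros [t [Ht Hc]]; apply is_numeralE in Ht; apply is_opairE in Hc.
  subst; auto.
- intros ->; exists (num k); rewrite is_numeralE, is_opairE; auto.
Qed.

Lemma tag2E k x y c : tag2 k x y c <-> c = op (num k) (op x y).
Proof.
split.
- intros [p [Hp Hc]]; apply is_opairE in Hp; apply tagE in Hc; subst; auto.
- intros ->; exists (op x y); rewrite tagE, is_opairE; auto.
Qed.

Lemma var_codeE n c : var_code n c <-> c = op emp n.
Proof. exact (tagE 0 n c). Qed.

Definition variables : M := prod (up emp emp) om.

Lemma mem_variables t : t ∈ variables <-> exists n, n ∈ om /\ t = op emp n.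
Proof.
unfold variables; rewrite mem_prod; split.
- intros [x [n [Hx [Hn ->]]]]; apply mem_up in Hx; exists n.
  destruct Hx as [->| ->]; auto.
- intros [n [Hn ->]]; exists emp, n; rewrite mem_up; auto.
Qed.

Lemma assignmentE (A : structure M) s : assignment A s <-> is_fun s om (univ A).
Proof.
split.
- intros [w [Hw Hs]]; apply is_omegaE in Hw; subst; auto.
- intro H; exists om; split; auto; apply is_omegaE; auto.
Qed.

Variable L : signature M.
Hypothesis no_functions : fun_arity L = emp.

Lemma no_function_maps f n : ~ maps (fun_arity L) f n.
Proof. rewrite no_functions, mapsE; apply not_mem_emp. Qed.

Lemma is_termE t : is_term L t <-> t ∈ variables.
Proof.
split.
- intro H; apply (H variables); split.
  + intros n c Hn Hc; apply mem_variables; exists n.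
    apply naturalE in Hn; apply var_codeE in Hc; auto.
  + intros f n u c Hf; destruct (no_function_maps Hf).
- intros Ht Z [HZ _]; apply mem_variables in Ht as [n [Hn ->]].
  apply (HZ n); [apply naturalE; auto | apply var_codeE; auto].
Qed.

(** Since [eval] quantifies over all closed sets, values are bounded from above by exhibiting one
    closed set: the pairs of v_n and s(n). It is closed because there is no function symbol. *)
Lemma eval_variable A s n y :
  assignment A s -> (eval L A s (op emp n) y <-> maps s n y).
Proof.
intro Hs; apply assignmentE in Hs; split.
- intro H.
  destruct (@sep_exists M hZF (fun p => exists n a c,
    maps s n a /\ var_code n c /\ is_opair c a p))
    with (a := prod variables (univ A)) as [Z HZ]; [dfn_auto|].
  assert (pair_in (op emp n) y Z) as Hy.
  { apply H; split.
    - intros m a c Hm Hc; apply pair_inE, HZ; split.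
      + apply mem_prod; exists c, a; split; [|split]; auto.
        * apply mem_variables; exists m; apply var_codeE in Hc; split; auto.
          apply (fun_mem Hs Hm).
        * apply (fun_mem Hs Hm).
      + exists m, a, c; rewrite is_opairE; auto.
    - intros f m F u b z c Hf; destruct (no_function_maps Hf). }
  apply pair_inE, HZ in Hy as [_ [m [a [c [Hm [Hc E]]]]]].
  apply var_codeE in Hc; subst c; apply is_opairE, op_inj in E as [E ->].
  apply op_inj in E as [_ ->]; auto.
- intros H Z [HZ _]; apply (HZ n); auto; apply var_codeE; auto.
Qed.

Variables D h : M.
Hypothesis rel_arity_fun : is_fun (rel_arity L) D om.
Hypothesis limit_h : limit h.
Hypothesis om_h : om ∈ h.
Hypothesis symbols_h : subset D (V h).

Lemma om_V : om ∈ V h.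
Proof. apply ordinal_subset_V; auto; apply limit_h. Qed.

Lemma variables_V : variables ∈ V h.
Proof.
apply (V_subset (x := pw (pw (cup (up emp emp) om)))); [apply limit_h| |].
- apply V_limit_pw, V_limit_pw, V_limit_cup; auto using om_V.
  apply V_limit_up; auto; apply V_limit_om; auto using emp_om.
- intros p Hp; apply mem_variables in Hp as [n [Hn ->]].
  apply mem_pw; intros z Hz; apply mem_pw; intros t Ht.
  apply mem_cup; rewrite mem_up; unfold op in Hz; apply mem_up in Hz.
  destruct Hz as [->| ->]; apply mem_up in Ht as [->| ->]; auto.
Qed.

Lemma term_V t : is_term L t -> t ∈ V h.
Proof.
rewrite is_termE; intro Ht.
exact (V_transitive (proj1 limit_h) variables_V Ht).
Qed.

Lemma tag_V k x : x ∈ V h -> op (num k) x ∈ V h.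
Proof. intro; apply V_limit_op; auto; apply V_limit_om; auto using num_om. Qed.

Lemma term_tuple_V u n : n ∈ om -> is_fun_on u n ->
  (forall i t, maps u i t -> is_term L t) -> u ∈ V h.
Proof.
intros Hn [Y Hu] Ht.
apply (@V_limit_fun _ _ h limit_h u n variables).
- apply is_funE; split; [|split].
  + intros p Hp; assert (Hp' := Hp).
    apply is_funE in Hu; destruct Hu as [H _]; apply H in Hp.
    destruct Hp as [x [y [Hx [_ ->]]]]; exists x, y; split; [|split]; auto.
    rewrite <- is_termE; apply (Ht x), mapsE, Hp'.
  + intros x Hx; destruct (fun_total Hu Hx) as [y [_ Hy]]; exists y.
    split; auto; rewrite <- is_termE; exact (Ht x y Hy).
  + intros x y y' Hy Hy'; exact (fun_functional Hu Hy Hy').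
- apply V_limit_om; auto.
- exact variables_V.
Qed.

(** Provides a set containing all formula codes. It bounds the closed set against which [denotes] is
    tested for an atomic formula. *)
Lemma formula_closed_V : formula_closed L (V h).
Proof.
split; [|split; [|split; [|split]]].
- intros t u c Ht Hu Hc; apply tag2E in Hc; subst c.
  apply tag_V, V_limit_op; auto using term_V.
- intros r n u c Hr Hu Ht Hc; apply tag2E in Hc; subst c.
  destruct (fun_mem rel_arity_fun Hr) as [Hr' Hn].
  apply tag_V, V_limit_op; auto; exact (term_tuple_V Hn Hu Ht).
- intros p c Hp Hc; apply tagE in Hc; subst c; apply tag_V; auto.
- intros p q c Hp Hq Hc; apply tag2E in Hc; subst c.
  apply tag_V, V_limit_op; auto.
- intros n p c Hn Hp Hc; apply tag2E in Hc; subst c.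
  apply tag_V, V_limit_op; auto; apply V_limit_om; auto; apply naturalE; auto.
Qed.

Lemma assignments_exist (A : structure M) : exists G, forall s, s ∈ G <-> assignment A s.
Proof.
destruct (@sep_exists M hZF (fun s => assignment A s))
  with (a := pw (prod om (univ A))) as [G HG]; [dfn_auto|].
exists G; intro s; rewrite HG; split; [tauto|intro H; split; auto].
apply mem_pw, fun_subset_prod, assignmentE, H.
Qed.

Lemma variable_tuple_exists n : n ∈ om ->
  exists u, is_fun u n variables /\
    forall i t, maps u i t <-> i ∈ n /\ t = op emp i.
Proof.
intro Hn.
assert (forall i, i ∈ n -> i ∈ om) as H
  by (intros i Hi; exact (ordinal_trans ordinal_om Hn Hi)).
destruct (@fun_exists M hZF (fun i t => var_code i t) n variables)
  as [u [Hu Hm]]; [dfn_auto| | |].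
- intros i Hi; exists (op emp i); split; [|apply var_codeE; auto].
  apply mem_variables; eauto.
- intros i t t' _ Ht Ht'; apply var_codeE in Ht; apply var_codeE in Ht'.
  congruence.
- exists u; split; auto; intros i t; rewrite Hm, var_codeE; split; [tauto|].
  intros [Hi ->]; split; [|split]; auto; apply mem_variables; eauto.
Qed.

(* [p] is the code of r(v_0, ..., v_(n-1)). *)
Lemma atomic_formula r n : maps (rel_arity L) r n ->
  exists p, is_formula L p /\
  forall (A : structure M) R, is_fun_on (rels A) D -> maps (rels A) r R ->
  (forall b, b ∈ R -> is_fun b n (univ A)) ->
  forall s, assignment A s ->
  (sat L A p s <->
   exists b, b ∈ R /\ forall i a, maps b i a -> maps s i a).
Proof.
intro Hr.
destruct (fun_mem rel_arity_fun Hr) as [HrD Hn].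
destruct (variable_tuple_exists Hn) as [u [Hu Hui]].
assert (forall i t, maps u i t -> is_term L t) as Hterm.
{ intros i t Ht; apply is_termE; exact (proj2 (fun_mem Hu Ht)). }
assert (is_fun_on u n) as Hu' by (exists variables; auto).
exists (op (num 1) (op r u)); split.
{ intros Z [_ [HZ _]]; apply (HZ r n u); auto; apply tag2E; auto. }
intros A R HA HrR HR s Hs.
destruct (@sep_exists M hZF (fun s => assignment A s /\ exists b, b ∈ R /\
  forall i t a, maps u i t -> maps b i a -> eval L A s t a))
  with (a := pw (prod om (univ A))) as [D0 HD]; [dfn_auto|].
assert (is_comprehension A (fun s => exists b, b ∈ R /\
  forall i t a, maps u i t -> maps b i a -> eval L A s t a) D0) as HD0.
{ intro s'; rewrite HD; split; [tauto|intro H; split; auto].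
  apply mem_pw, fun_subset_prod, assignmentE, H. }
assert (s ∈ D0 <-> exists b, b ∈ R /\ forall i a, maps b i a -> maps s i a)
  as HsD.
{ rewrite (HD0 s); split.
  - intros [_ [b [Hb H]]]; exists b; split; auto; intros i a Hia.
    apply (eval_variable i a Hs), (H i); auto; apply Hui; split; auto.
    apply (fun_mem (HR b Hb) Hia).
  - intros [b [Hb H]]; split; auto; exists b; split; auto.
    intros i t a Ht Hia; apply Hui in Ht as [_ ->].
    apply eval_variable; auto. }
rewrite <- HsD; split.
- intros [D1 [H1 Hs1]].
  destruct (assignments_exist A) as [G HG].
  (* This test set pairs codes in [V h] with arbitrary sets of assignments, except that the atomic
     code may be paired with [D0] only. Tarski's clauses for codes with another tag thus hold for
     free, and the clause for relations reduces to the injectivity of the coding. *)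
  destruct (@sep_exists M hZF
    (fun p => forall D', is_opair (op (num 1) (op r u)) D' p -> D' = D0))
    with (a := prod (V h) (pw G)) as [Z HZ]; [dfn_auto|].
  enough (pair_in (op (num 1) (op r u)) D1 Z) as HD1.
  { apply pair_inE, HZ in HD1 as [_ HD1].
    rewrite (HD1 D1) in Hs1; auto; apply is_opairE; auto. }
  apply H1.
  assert (forall c E P, c ∈ V h -> is_comprehension A P E ->
    (c = op (num 1) (op r u) -> E = D0) -> pair_in c E Z) as Hin.
  { intros c E P Hc HE Heq; apply pair_inE, HZ; split.
    - apply mem_prod; exists c, E; split; [|split]; auto.
      apply mem_pw; intros s' Hs'; apply HG, HE, Hs'.
    - intros D' E'; apply is_opairE, op_inj in E' as [-> ->]; auto. }
  assert (forall k x, k <> 1 -> op (num k) x = op (num 1) (op r u) -> False)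
    as Htag.
  { intros k x Hk E; apply op_inj in E as [E _]; apply num_inj in E; auto. }
  assert (forall p E, pair_in p E Z -> p ∈ V h) as Hp.
  { intros p E Hp; apply pair_inE, HZ in Hp as [Hp _].
    apply mem_prod in Hp as [x [y [Hx [_ E']]]].
    apply op_inj in E' as [-> _]; auto. }
  destruct formula_closed_V as [F1 [F2 [F3 [F4 F5]]]].
  split; [|split; [|split; [|split]]].
  + intros t t' c E Ht Ht' Hc HE; apply (Hin _ _ _ (F1 _ _ _ Ht Ht' Hc) HE).
    apply tag2E in Hc; subst c; intro E'; destruct (@Htag 0 _ (O_S 0) E').
  + intros r' n' R' u' c E Hr' HR' Hu'' Ht Hc HE.
    apply (Hin _ _ _ (F2 _ _ _ _ Hr' Hu'' Ht Hc) HE).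
    apply tag2E in Hc; subst c; intro E'.
    apply op_inj in E' as [_ E']; apply op_inj in E' as [-> ->].
    destruct HA as [Y HA].
    rewrite (fun_functional HA HR' HrR) in HE.
    apply ext; intro s'; rewrite (HE s'), (HD0 s'); tauto.
  + intros p E' c E Hp' Hc HE.
    apply (Hin _ _ _ (F3 _ _ (Hp _ _ Hp') Hc) HE).
    apply tagE in Hc; subst c; intro E''; edestruct (@Htag 2); eauto.
  + intros p q E' E'' c E Hp' Hq' Hc HE.
    apply (Hin _ _ _ (F4 _ _ _ (Hp _ _ Hp') (Hp _ _ Hq') Hc) HE).
    apply tag2E in Hc; subst c; intro E3; edestruct (@Htag 3); eauto.
  + intros m p E' c E Hm Hp' Hc HE.
    apply (Hin _ _ _ (F5 _ _ _ Hm (Hp _ _ Hp') Hc) HE).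
    apply tag2E in Hc; subst c; intro E3; edestruct (@Htag 4); eauto.
- intro HsD0; exists D0; split; auto.
  intros Z [_ [HZ _]]; apply (HZ r n R u); auto; apply tag2E; auto.
Qed.

(** Besides the fact that [j] is a function, this is all that is ever extracted from an embedding
    supplied by VP. *)
Lemma elementary_atomic (A B : structure M) j r n R S : maps (rel_arity L) r n ->
  is_fun_on (rels A) D -> maps (rels A) r R ->
  (forall b, b ∈ R -> is_fun b n (univ A)) ->
  is_fun_on (rels B) D -> maps (rels B) r S ->
  (forall b, b ∈ S -> is_fun b n (univ B)) ->
  elementary L A B j ->
  forall s s', assignment A s -> assignment B s' -> is_image_assignment j s s' ->
  ((exists b, b ∈ R /\ forall i a, maps b i a -> maps s i a) <->
   (exists b, b ∈ S /\ forall i a, maps b i a -> maps s' i a)).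
Proof.
intros Hr HA HrR HR HB HrS HS [_ Hj] s s' Hs Hs' Hss'.
destruct (atomic_formula Hr) as [p [Hp H]].
rewrite <- (H A R HA HrR HR s Hs), <- (H B S HB HrS HS s' Hs').
apply Hj; auto.
Qed.

End AtomicFormulas.

(** * Vopenka's principle for structures with ternary relations *)

Section TernaryStructures.

Context {M : set_model} {hZF : ZF M}.
Implicit Types (a b c x y z : M).

Lemma mem_num3 i : i ∈ num 3 <-> i = num 0 \/ i = num 1 \/ i = num 2.
Proof.
simpl; rewrite !mem_sc; assert (H := @not_mem_emp M hZF i); tauto.
Qed.

Lemma num3_om i : i ∈ num 3 -> i ∈ om.
Proof. exact (fun H => ordinal_trans ordinal_om (num_om 3) H). Qed.

Definition values f x y z : Prop :=
  maps f (num 0) x /\ maps f (num 1) y /\ maps f (num 2) z.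

(** Serves for triples, with [n] equal to [num 3], and for assignments, with [n] equal to [om]; in
    the latter case all positions from 2 on carry [z]. *)
Lemma sequence_exists n u x y z : x ∈ u -> y ∈ u -> z ∈ u -> subset (num 3) n ->
  exists f, is_fun f n u /\ values f x y z /\
    forall i a, maps f i a -> i <> num 0 -> i <> num 1 -> a = z.
Proof.
intros Hx Hy Hz Hn.
destruct (@fun_exists M hZF (fun i a => (i = num 0 /\ a = x) \/
  (i = num 1 /\ a = y) \/ (i <> num 0 /\ i <> num 1 /\ a = z)) n u)
  as [f [Hf Hm]]; [dfn_auto| | |].
- intros i _; destruct (classic (i = num 0)), (classic (i = num 1));
    [exists x|exists x|exists y|exists z]; tauto.
- intros i a a' _ H H'.
  assert (num 0 <> num 1) by (intro E; apply num_inj in E; discriminate).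
  intuition congruence.
- assert (num 0 <> num 2) by (intro E; apply num_inj in E; discriminate).
  assert (num 1 <> num 2) by (intro E; apply num_inj in E; discriminate).
  exists f; split; auto; split; [split; [|split]|]; try apply Hm.
  + split; [apply Hn, mem_num3|]; auto.
  + split; [apply Hn, mem_num3|]; auto.
  + split; [apply Hn, mem_num3|]; intuition.
  + intros i a Hi Hi0 Hi1; apply Hm in Hi; tauto.
Qed.

Variable D : M.
Variable Phi : M -> M -> M -> M -> M -> Prop.
Hypothesis dfn_Phi :
  forall l d x y z : (nat -> M) -> M, is_arg l -> is_arg d -> is_arg x ->
  is_arg y -> is_arg z -> dfn (fun e => Phi (l e) (d e) (x e) (y e) (z e)).
Hint Resolve dfn_Phi : dfn.

(** [Phi] may depend on the index [l]. A symbol can therefore name the index itself, which forces an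
    embedding to send one index to the other. *)
Definition interpretation (l d u T : M) : Prop :=
  forall b, b ∈ T <-> is_fun b (num 3) u /\
    exists x y z, values b x y z /\ Phi l d x y z.

Definition interpretations (l u R : M) : Prop :=
  forall p, p ∈ R <-> exists d T, d ∈ D /\ interpretation l d u T /\ is_opair d T p.

Lemma dfn_values (f x y z : (nat -> M) -> M) :
  is_arg f -> is_arg x -> is_arg y -> is_arg z ->
  dfn (fun e => values (f e) (x e) (y e) (z e)).
Proof. intros; unfold values; dfn_auto. Qed.
Hint Resolve dfn_values : dfn.

Lemma dfn_interpretation (l d u T : (nat -> M) -> M) :
  is_arg l -> is_arg d -> is_arg u -> is_arg T ->
  dfn (fun e => interpretation (l e) (d e) (u e) (T e)).
Proof. intros; unfold interpretation; dfn_auto. Qed.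
Hint Resolve dfn_interpretation : dfn.

Lemma dfn_interpretations (l u R : (nat -> M) -> M) :
  is_arg l -> is_arg u -> is_arg R ->
  dfn (fun e => interpretations (l e) (u e) (R e)).
Proof. intros; unfold interpretations; dfn_auto. Qed.
Hint Resolve dfn_interpretations : dfn.

Lemma interpretation_exists l d u : exists T, interpretation l d u T /\
  T ∈ pw (pw (prod (num 3) u)).
Proof.
destruct (@sep_exists M hZF (fun b => is_fun b (num 3) u /\
    exists x y z, values b x y z /\ Phi l d x y z))
  with (a := pw (prod (num 3) u)) as [T HT]; [dfn_auto|].
exists T; split.
- intro b; rewrite HT; split; [tauto|]; intro H; split; auto.
  apply mem_pw, fun_subset_prod, H.
- apply mem_pw; intros b Hb; apply HT in Hb; tauto.
Qed.

Lemma interpretation_unique l d u T T' :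
  interpretation l d u T -> interpretation l d u T' -> T = T'.
Proof. intros H H'; apply ext; intro b; rewrite (H b), (H' b); tauto. Qed.

Lemma interpretations_exists l u : exists R, interpretations l u R /\
  is_fun_on R D /\ forall d T, d ∈ D -> interpretation l d u T -> maps R d T.
Proof.
destruct (@fun_exists M hZF (fun d T => interpretation l d u T) D
  (pw (pw (prod (num 3) u)))) as [R [HR Hm]]; [dfn_auto| | |].
- intros d _; destruct (interpretation_exists l d u) as [T [H H']]; eauto.
- intros d T T' _; apply interpretation_unique.
- assert (forall d T, d ∈ D -> interpretation l d u T -> maps R d T) as H.
  { intros d T Hd HT; apply Hm; split; auto; split; auto.
    destruct (interpretation_exists l d u) as [T' [H' HT']].
    rewrite (interpretation_unique HT H'); auto. }
  exists R; split; [|split]; auto; [|eexists; eauto].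
  intro p; split.
  + intro Hp; assert (Hp' := fun_subset_prod HR Hp).
    apply mem_prod in Hp' as [d [T [Hd [_ ->]]]].
    apply mapsE, Hm in Hp as [_ [_ Hp]].
    exists d, T; rewrite is_opairE; auto.
  + intros [d [T [Hd [HT Hp]]]]; apply is_opairE in Hp; subst.
    apply mapsE; auto.
Qed.

Lemma interpretations_unique l u R R' :
  interpretations l u R -> interpretations l u R' -> R = R'.
Proof. intros H H'; apply ext; intro p; rewrite (H p), (H' p); tauto. Qed.

Lemma interpretations_fun l u R : interpretations l u R ->
  is_fun_on R D /\ forall d T, maps R d T <-> d ∈ D /\ interpretation l d u T.
Proof.
intro HR; destruct (interpretations_exists l u) as [R' [HR' [Hf Hm]]].
rewrite <- (interpretations_unique HR HR') in *; split; auto.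
intros d T; split; [|intros [Hd HT]; auto].
intro H; apply mapsE, HR in H as [d' [T' [Hd' [HT' E]]]].
apply is_opairE, op_inj in E as [-> ->]; auto.
Qed.

(** The left-hand side is the form in which [atomic_formula] expresses the truth of d(v_0, v_1,
    v_2); the triple [b] is the restriction of [s] to [num 3]. *)
Lemma interpretation_sequence l d u T n s x y z : interpretation l d u T ->
  subset (num 3) n -> x ∈ u -> y ∈ u -> z ∈ u ->
  is_fun s n u -> values s x y z ->
  ((exists b, b ∈ T /\ forall i a, maps b i a -> maps s i a) <-> Phi l d x y z).
Proof.
intros HT Hn Hx Hy Hz Hs [H0 [H1 H2]]; split.
- intros [b [Hb H]]; apply HT in Hb as [_ [x' [y' [z' [[G0 [G1 G2]] HP]]]]].
  rewrite (fun_functional Hs H0 (H _ _ G0)), (fun_functional Hs H1 (H _ _ G1)),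
    (fun_functional Hs H2 (H _ _ G2)); auto.
- intro HP.
  destruct (@sequence_exists (num 3) u x y z) as [b [Hb [Hv _]]]; auto;
    [intros i Hi; auto|].
  exists b; split; [apply HT; split; eauto 6|].
  intros i a Hi; assert (Hi' := proj1 (fun_mem Hb Hi)).
  destruct Hv as [G0 [G1 G2]]; apply mem_num3 in Hi' as [->|[->| ->]].
  + rewrite (fun_functional Hb Hi G0); auto.
  + rewrite (fun_functional Hb Hi G1); auto.
  + rewrite (fun_functional Hb Hi G2); auto.
Qed.

Variable index : M -> Prop.
Variable universe : M -> M -> Prop.
Hypothesis dfn_index : dfn1 index.
Hypothesis dfn_universe : dfn2 universe.
Hypothesis index_unbounded : forall w, exists l, index l /\ ~ l ∈ w.
Hypothesis universe_exists : forall l, index l -> exists u, universe l u /\ l ∈ u.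
Hypothesis universe_unique :
  forall l u u', universe l u -> universe l u' -> u = u'.

Definition ternary_structure (s : M) : Prop :=
  exists l u R p, (index l /\ universe l u /\ l ∈ u) /\ interpretations l u R /\
    is_opair R emp p /\ is_opair u p s.

(** The membership chain l ∈ u ∈ {u} ∈ s, with [s] the code of the structure, recovers the index by
    three unions. A set of all these structures would hence bound the indices. *)
Lemma ternary_structure_proper : proper_class ternary_structure.
Proof.
intros [S HS].
destruct (index_unbounded (un (un (un S)))) as [l [Hl Hn]].
destruct (universe_exists Hl) as [u [Hu Hlu]].
destruct (interpretations_exists l u) as [R [HR _]].
apply Hn, mem_un; exists u; split; auto.
apply mem_un; exists (up u u); split; [|apply mem_up; auto].
apply mem_un; exists (op u (op R emp)); split; [|apply mem_up; auto].
apply HS; exists l, u, R, (op R emp); rewrite !is_opairE; auto.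
Qed.

Theorem VP_ternary (hVP : VP M) (HD : ordinal D) (om_D : om ∈ D) :
  exists l m u v j, l <> m /\ index l /\ index m /\
    universe l u /\ universe m v /\ is_fun j u v /\
    forall d x y z x' y' z', d ∈ D -> maps j x x' -> maps j y y' -> maps j z z' ->
      (Phi l d x y z <-> Phi m d x' y' z').
Proof.
(* Every symbol gets arity 3; a relation of fewer arguments ignores the others. *)
destruct (@fun_exists M hZF (fun d n => n = num 3) D om) as [ar [Har Hm]];
  [dfn_auto|intros d _; exists (num 3); auto using num_om
  |intros; congruence|].
set (L := Signature ar emp).
assert (is_fun (@emp M hZF) emp om) as Hemp.
{ apply is_funE; split; [|split].
  - intros p Hp; destruct (not_mem_emp Hp).
  - intros p Hp; destruct (not_mem_emp Hp).
  - intros x y y' H; apply mapsE in H; destruct (not_mem_emp H). }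
assert (forall l u R T d, interpretations l u R -> maps R d T ->
  forall b, b ∈ T -> is_fun b (num 3) u) as HT.
{ intros l u R T d HR HdT b Hb.
  destruct (interpretations_fun HR) as [_ H]; apply H in HdT as [_ HdT].
  apply HdT in Hb; tauto. }
destruct (hVP L ternary_structure) as [s [t [A [B [j [Hs [Ht [Hst [HA [HB Hj]]]]]]]]]].
- exists om, D, emp; split; [apply is_omegaE; auto|split]; auto.
- apply (definable_dfn D); unfold ternary_structure; dfn_auto.
- exact ternary_structure_proper.
- intros s [l [u [R [p [[Hl [Hu Hlu]] [HR [Hp Hs]]]]]]].
  destruct (interpretations_fun HR) as [HRf HRm].
  exists (Structure u R emp); split; [exists p; auto|].
  split; [exists l; auto|split; [|split; [|split]]]; simpl.
  + exists om, D; split; [apply is_omegaE; auto|split; auto].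
  + exists om, emp; split; [apply is_omegaE; auto|split; auto].
    exists om; auto.
  + intros r n T Hr HrT b Hb; apply Hm in Hr as [_ [_ ->]].
    exact (HT _ _ _ _ _ HR HrT b Hb).
  + intros f n F Hf; apply mapsE in Hf; destruct (not_mem_emp Hf).
- destruct Hs as [l [u [R [p [[Hl [Hu Hlu]] [HR [Hp Hs]]]]]]].
  destruct Ht as [m [v [R' [p' [[Hm' [Hv Hmv]] [HR' [Hp' Ht]]]]]]].
  rewrite is_opairE in *; subst.
  destruct A as [u0 R0 F0], B as [v0 R0' F0'].
  destruct HA as [q [Hq HA]], HB as [q' [Hq' HB]]; simpl in *.
  rewrite is_opairE in *.
  apply op_inj in HA as [<- <-]; apply op_inj in HB as [<- <-].
  apply op_inj in Hq as [<- <-]; apply op_inj in Hq' as [<- <-].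
  exists l, m, u, v, j; split; [|split; [|split; [|split; [|split]]]]; auto.
  (* The index determines its structure, so distinct structures come from distinct indices. *)
  { intros <-; apply Hst.
    rewrite (universe_unique Hu Hv) in *.
    rewrite (interpretations_unique HR HR'); auto. }
  split; [exact (proj1 Hj)|].
  intros d x y z x' y' z' Hd Hx Hy Hz.
  assert (Hjf := proj1 Hj); simpl in Hjf.
  destruct (fun_mem Hjf Hx) as [Ux Vx], (fun_mem Hjf Hy) as [Uy Vy],
    (fun_mem Hjf Hz) as [Uz Vz].
  assert (subset (@num M hZF 3) om) as Hn3 by (intros i; apply num3_om).
  destruct (@sequence_exists om u x y z) as [a [Ha [Hav Haz]]]; auto.
  destruct (@sequence_exists om v x' y' z') as [a' [Ha' [Hav' Haz']]]; auto.
  destruct (interpretations_fun HR) as [HRf HRm].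
  destruct (interpretations_fun HR') as [HRf' HRm'].
  destruct (interpretation_exists l d u) as [T [HTi _]].
  destruct (interpretation_exists m d v) as [T' [HTi' _]].
  rewrite <- (interpretation_sequence HTi Hn3 Ux Uy Uz Ha Hav).
  rewrite <- (interpretation_sequence HTi' Hn3 Vx Vy Vz Ha' Hav').
  destruct (limit_above HD) as [h [Hh HDh]].
  apply (@elementary_atomic M hZF L eq_refl D h Har Hh
    (ordinal_trans (proj1 Hh) HDh om_D)) with (r := d) (n := num 3) (j := j)
    (A := Structure u R emp) (B := Structure v R' emp); simpl; auto.
  + intros r Hr; apply ordinal_subset_V; [apply Hh|].
    exact (ordinal_trans (proj1 Hh) HDh Hr).
  + apply Hm; split; [|split]; auto; exact (num_om 3).
  + apply HRm; auto.
  + apply (HT l u R T d); auto; apply HRm; auto.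
  + apply HRm'; auto.
  + apply (HT m v R' T' d); auto; apply HRm'; auto.
  + apply assignmentE; auto.
  + apply assignmentE; auto.
  + intros i b b' Hi Hb.
    destruct Hav as [G0 [G1 G2]], Hav' as [G0' [G1' G2']].
    destruct (classic (i = num 0)) as [->|Hi0].
    { rewrite (fun_functional Ha Hi G0) in Hb.
      rewrite (fun_functional Hjf Hb Hx); auto. }
    destruct (classic (i = num 1)) as [->|Hi1].
    { rewrite (fun_functional Ha Hi G1) in Hb.
      rewrite (fun_functional Hjf Hb Hy); auto. }
    rewrite (Haz i b Hi Hi0 Hi1) in Hb.
    destruct (fun_total Ha' (proj1 (fun_mem Ha Hi))) as [c [_ Hc]].
    rewrite (fun_functional Hjf Hb Hz), <- (Haz' i c Hc Hi0 Hi1); auto.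
Qed.

End TernaryStructures.

Lemma dfn_limit {M : set_model} {hZF : ZF M} (a : (nat -> M) -> M) :
  is_arg a -> dfn (fun e => limit (a e)).
Proof.
intro Ha.
apply (@dfn_ext M (fun e => ordinal (a e) /\ (exists z, is_empty z /\ z ∈ a e) /\
  forall b, b ∈ a e -> exists s, is_succ b s /\ s ∈ a e)); [|dfn_auto].
intro e; unfold limit; split; intros [H1 [H2 H3]]; split; auto; split.
- destruct H2 as [z [Hz H2]]; apply is_emptyE in Hz; subst; auto.
- intros b Hb; destruct (H3 b Hb) as [s [Hs H]]; apply is_succE in Hs.
  subst; auto.
- exists emp; rewrite is_emptyE; auto.
- intros b Hb; exists (sc b); rewrite is_succE; auto.
Qed.
#[global] Hint Resolve dfn_limit : dfn.

(** * The structures *)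

Section PredicateList.

Context {M : set_model} {hZF : ZF M}.

(* Symbol [num (k + i)] is interpreted by the [i]-th predicate of the list and
   every other symbol [d] by the constant [d]. *)
Fixpoint select (k : nat) (ps : list (M -> M -> M -> M -> Prop))
    (l d x y z : M) : Prop :=
  match ps with
  | nil => x = d
  | p :: ps => (d = num k /\ p l x y z) \/ (d <> num k /\ select (S k) ps l d x y z)
  end.

Definition dfn4 (P : M -> M -> M -> M -> Prop) : Prop :=
  forall l x y z : (nat -> M) -> M, is_arg l -> is_arg x -> is_arg y ->
  is_arg z -> dfn (fun e => P (l e) (x e) (y e) (z e)).

Lemma dfn_select ps : Forall dfn4 ps -> forall k (l d x y z : (nat -> M) -> M),
  is_arg l -> is_arg d -> is_arg x -> is_arg y -> is_arg z ->
  dfn (fun e => select k ps (l e) (d e) (x e) (y e) (z e)).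
Proof.
induction ps as [|p ps IH]; intros Hps k l d x y z Hl Hd Hx Hy Hz; cbn [select].
- dfn_auto.
- inversion_clear Hps.
  apply dfn_or; apply dfn_and; [dfn_auto|auto|dfn_auto|apply IH; auto].
Qed.

Lemma select_nth ps : forall i p k l x y z, nth_error ps i = Some p ->
  (select k ps l (num (k + i)) x y z <-> p l x y z).
Proof.
induction ps as [|q ps IH]; intros [|i] p k l x y z H; simpl in H;
  try discriminate; cbn [select].
- injection H as ->; rewrite Nat.add_0_r; tauto.
- rewrite <- Nat.add_succ_comm, (IH i p (S k) l x y z H).
  assert (num (S k + i) <> num k); [|tauto].
  intro E; apply num_inj in E; lia.
Qed.

Lemma select_constant ps l d x y z : ~ d ∈ om ->
  forall k, select k ps l d x y z <-> x = d.
Proof.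
intro Hd; induction ps as [|p ps IH]; intro k; cbn [select]; [tauto|].
rewrite IH; assert (d <> num k); [|tauto].
intros ->; apply Hd, num_om.
Qed.

End PredicateList.

(** * Satisfaction in structures of the form (v, ∈) *)

Section SetStructures.

Context {M : set_model} {hZF : ZF M}.
Implicit Types (a b c x y z : M).

Definition set_sig : signature M :=
  Signature (up (op emp (num 2)) (op emp (num 2))) emp.

Lemma set_signatureE (L : signature M) : set_signature L <-> L = set_sig.
Proof.
destruct L as [r f]; unfold set_signature, set_sig; simpl; split.
- intros [Hr Hf]; apply is_emptyE in Hf; f_equal; auto.
  apply ext; intro p; rewrite mem_up, Hr; split.
  + intros [z [t [Hz [Ht Hp]]]].
    apply is_emptyE in Hz; apply is_opairE in Hp.
    change (is_numeral 2 t) in Ht; apply is_numeralE in Ht.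
    subst; auto.
  + intro Hp; exists emp, (num 2).
    change (is_empty emp /\ is_numeral 2 (num 2) /\ is_opair emp (num 2) p).
    rewrite is_emptyE, is_numeralE, is_opairE; tauto.
- intro E; injection E as -> ->; split; [|apply is_emptyE; auto].
  intro p; rewrite mem_up; split.
  + intro Hp; exists emp, (num 2).
    change (is_empty emp /\ is_numeral 2 (num 2) /\ is_opair emp (num 2) p).
    rewrite is_emptyE, is_numeralE, is_opairE; tauto.
  + intros [z [t [Hz [Ht Hp]]]].
    apply is_emptyE in Hz; apply is_opairE in Hp.
    change (is_numeral 2 t) in Ht; apply is_numeralE in Ht.
    subst; auto.
Qed.

Lemma set_sig_arity r n : maps (rel_arity set_sig) r n -> r = emp /\ n = num 2.
Proof.
intro H; apply mapsE, mem_up in H.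
destruct H as [H|H]; apply op_inj in H; auto.
Qed.

Lemma mem_structure_exists v : exists A : structure M, is_mem_structure v A.
Proof.
destruct (@sep_exists M hZF (fun s => (exists t, is_numeral 2 t /\ is_fun s t v) /\
    (exists i0 i1 x y, is_numeral 0 i0 /\ is_numeral 1 i1 /\
       maps s i0 x /\ maps s i1 y /\ x ∈ y))) with (a := pw (prod (num 2) v))
  as [R HR]; [dfn_auto|].
assert (is_mem_relation v R) as HR'.
{ intro s; rewrite HR; split; [tauto|intro H; split; auto].
  destruct H as [[t [Ht H]] _]; apply is_numeralE in Ht; subst t.
  apply mem_pw, fun_subset_prod, H. }
exists (Structure v (up (op emp R) (op emp R)) emp).
split; [|split]; simpl; auto; [|apply is_emptyE; auto].
intro p; rewrite mem_up; split.
- intro Hp; exists emp, R; change (is_empty emp /\ is_mem_relation v R /\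
    is_opair emp R p).
  rewrite is_emptyE, is_opairE; tauto.
- intros [z [R' [Hz [HR'' Hp]]]].
  apply is_emptyE in Hz; apply is_opairE in Hp; subst.
  assert (R' = R) as ->; auto.
  apply ext; intro s; rewrite (HR' s); apply HR''.
Qed.

Lemma mem_structure_unique v (A B : structure M) :
  is_mem_structure v A -> is_mem_structure v B -> A = B.
Proof.
destruct A as [u r f], B as [u' r' f']; unfold is_mem_structure; simpl.
intros [-> [Hr Hf]] [-> [Hr' Hf']]; apply is_emptyE in Hf, Hf'; subst.
f_equal; apply ext; intro p; rewrite (Hr p), (Hr' p); tauto.
Qed.

(** Quantifying the signature and the structure away leaves a relation between three elements of the
    model, which can then be one of the relations that [j] respects. *)
Definition satisfies (v p s : M) : Prop :=
  exists L A, set_signature L /\ is_mem_structure v A /\ sat L A p s.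

Lemma satisfiesE v (A : structure M) p s :
  is_mem_structure v A -> (satisfies v p s <-> sat set_sig A p s).
Proof.
intro HA; split.
- intros [L [B [HL [HB H]]]]; apply set_signatureE in HL; subst L.
  rewrite (mem_structure_unique HA HB); auto.
- intro H; exists set_sig, A; rewrite set_signatureE; auto.
Qed.

End SetStructures.

(** * The relations and universes of the structures attached to the club *)

Section Predicates.

Context {M : set_model} {hZF : ZF M}.
Implicit Types (a b c d x y z l : M).

Variable C : M -> Prop.
Hypothesis definable_C : dfn1 C.
Hypothesis club_C : club_class C.

Definition next b c : Prop :=
  C c /\ b ∈ c /\ forall d, d ∈ c -> C d -> ~ b ∈ d.

Definition least_equinumerous d b : Prop :=
  b ∈ d /\ (exists f, bijection f b d) /\
  forall c, c ∈ b -> ~ exists f, bijection f c d.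

Definition no_embedding d z l : Prop :=
  ordinal l /\ d ∈ l /\
  ~ exists j k, rank_embedding l j /\ is_crit j k /\ z ∈ k /\ k ∈ d /\ maps j d d.

Definition least_bad d z : Prop :=
  ordinal z /\ z ∈ d /\ (exists l, no_embedding d z l) /\
  forall y, y ∈ z -> ~ exists l, no_embedding d y l.

Definition least_stage d l : Prop :=
  exists z, least_bad d z /\ no_embedding d z l /\
    forall k, k ∈ l -> ~ no_embedding d z k.

(* V_h contains, for each d < l, the first stage at which d fails to be
   rank-Berkeley. *)
Definition height l h : Prop :=
  limit h /\ l ∈ h /\ om ∈ h /\ forall d b, d ∈ l -> least_stage d b -> b ∈ h.

Definition universe l u : Prop :=
  exists h, height l h /\ (forall k, k ∈ h -> ~ height l k) /\ is_V h u.

(* Every notion that [j] has to respect is a relation of the structures, so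
   that the elementarity of [j] is used for atomic formulas only; the first
   predicate makes [l] a constant. *)
Definition predicates : list (M -> M -> M -> M -> Prop) :=
  (fun l x y z => x = l) ::
  (fun l x y z => x ∈ y) ::
  (fun l x y z => is_empty x) ::
  (fun l x y z => is_succ x y) ::
  (fun l x y z => ordinal x) ::
  (fun l x y z => bijection x y z) ::
  (fun l x y z => cofinal_map x y z) ::
  (fun l x y z => maps x y z) ::
  (fun l x y z => is_V x y) ::
  (fun l x y z => next x y) ::
  (fun l x y z => is_fun x om y) ::
  (fun l x y z => satisfies x y z) ::
  (fun l x y z => least_equinumerous x y) ::
  (fun l x y z => least_bad x y) ::
  (fun l x y z => least_stage x y) ::
  (fun l x y z => is_pair x y z) :: nil.

Lemma dfn_no_embedding (d z l : (nat -> M) -> M) :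
  is_arg d -> is_arg z -> is_arg l ->
  dfn (fun e => no_embedding (d e) (z e) (l e)).
Proof. intros; unfold no_embedding; dfn_auto. Qed.
Hint Resolve dfn_no_embedding : dfn.

Lemma dfn_least_bad (d z : (nat -> M) -> M) :
  is_arg d -> is_arg z -> dfn (fun e => least_bad (d e) (z e)).
Proof. intros; unfold least_bad; dfn_auto. Qed.
Hint Resolve dfn_least_bad : dfn.

Lemma dfn_least_stage (d l : (nat -> M) -> M) :
  is_arg d -> is_arg l -> dfn (fun e => least_stage (d e) (l e)).
Proof. intros; unfold least_stage; dfn_auto. Qed.
Hint Resolve dfn_least_stage : dfn.

Lemma dfn_height (l h : (nat -> M) -> M) :
  is_arg l -> is_arg h -> dfn (fun e => height (l e) (h e)).
Proof. intros; unfold height; dfn_auto. Qed.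
Hint Resolve dfn_height : dfn.

Lemma dfn_universe : dfn2 universe.
Proof. unfold universe; dfn_auto. Qed.

Lemma dfn_predicates : Forall dfn4 predicates.
Proof.
unfold predicates; repeat constructor; intros l x y z Hl Hx Hy Hz;
  unfold next, satisfies, least_equinumerous; dfn_auto.
Qed.

Lemma ordinal_C c : C c -> ordinal c.
Proof. apply club_C. Qed.

Lemma C_unbounded w : exists l, C l /\ ~ l ∈ w.
Proof.
destruct (@sep_exists M hZF (fun x => ordinal x)) with (a := w) as [o Ho];
  [dfn_auto|].
assert (ordinal (un o)) as Oo.
{ apply ordinal_un; intros x Hx; apply Ho in Hx; tauto. }
destruct club_C as [HC [HU _]].
destruct (HU _ Oo) as [c [Hc Hoc]]; exists c; split; auto.
intro Hcw; apply (@not_mem_self M hZF (un o)), mem_un; exists c; split; auto.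
apply Ho; auto.
Qed.

Lemma next_unique b c c' : next b c -> next b c' -> c = c'.
Proof.
intros [H1 [H2 H3]] [H1' [H2' H3']].
destruct (ordinal_trichotomy (ordinal_C H1) (ordinal_C H1')) as [H|[H|H]]; auto.
- destruct (H3' c H H1 H2).
- destruct (H3 c' H H1' H2').
Qed.

Lemma least_equinumerous_unique d b b' : ordinal d ->
  least_equinumerous d b -> least_equinumerous d b' -> b = b'.
Proof.
intros Hd [H1 [H2 H3]] [H1' [H2' H3']].
destruct (ordinal_trichotomy (ordinal_mem Hd H1) (ordinal_mem Hd H1'))
  as [H|[H|H]]; auto.
- destruct (H3' b H H2).
- destruct (H3 b' H H2').
Qed.

Lemma least_bad_unique d z z' : least_bad d z -> least_bad d z' -> z = z'.
Proof.
intros [O1 [H1 [H2 H3]]] [O1' [H1' [H2' H3']]].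
destruct (ordinal_trichotomy O1 O1') as [H|[H|H]]; auto.
- destruct (H3' z H H2).
- destruct (H3 z' H H2').
Qed.

Lemma least_stage_unique d l l' : least_stage d l -> least_stage d l' -> l = l'.
Proof.
intros [z [Hz [H1 H2]]] [z' [Hz' [H1' H2']]].
rewrite (least_bad_unique Hz' Hz) in *.
destruct (ordinal_trichotomy (proj1 H1) (proj1 H1')) as [H|[H|H]]; auto.
- destruct (H2' l H H1).
- destruct (H2 l' H H1').
Qed.

(** As [least_stage] is functional, Replacement over the elements of [l] collects the failing stages
    into a set, and a limit above its union together with [l] and [om] will do. *)
Lemma height_exists l : ordinal l -> exists h, height l h.
Proof.
intro Hl.
destruct (@repl_exists M hZF least_stage) with (a := l) as [W HW];
  [dfn_auto|intros x y y' _; apply least_stage_unique|].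
set (S := cup W (up l om)).
assert (forall b, b ∈ S -> ordinal b) as HS.
{ intros b Hb; apply mem_cup in Hb as [Hb|Hb].
  - apply HW in Hb as [d [_ [z [_ [[Hb _] _]]]]]; auto.
  - apply mem_up in Hb as [->| ->]; auto; exact ordinal_om. }
destruct (limit_above (ordinal_un HS)) as [h [Hh Hu]].
assert (forall b, b ∈ S -> b ∈ h) as Hb.
{ intros b Hb; destruct (classic (b = un S)) as [->|Hne]; auto.
  apply (ordinal_trans (b := un S)); auto; [apply Hh|].
  apply ordinal_subset_mem; auto; [apply ordinal_un; auto|].
  intros x Hx; apply mem_un; eauto. }
exists h; split; [|split; [|split]]; auto.
- apply Hb, mem_cup; rewrite mem_up; auto.
- apply Hb, mem_cup; rewrite mem_up; auto.
- intros d b Hd H; apply Hb, mem_cup; left; apply HW; eauto.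
Qed.

Lemma universe_exists l : C l -> exists u, universe l u /\ l ∈ u.
Proof.
intro Hl; apply ordinal_C in Hl.
destruct (@ordinal_least M hZF (fun h => height l h)) as [h [Oh [Hh Hmin]]].
- dfn_auto.
- destruct (height_exists Hl) as [h Hh]; exists h; split; auto; apply Hh.
- exists (V h); split.
  + exists h; split; [|split]; auto; apply is_VVE; auto.
  + apply ordinal_subset_V; auto; apply Hh.
Qed.

Lemma universe_unique l u u' : universe l u -> universe l u' -> u = u'.
Proof.
intros [h [Hh [H Hu]]] [h' [Hh' [H' Hu']]].
apply is_VVE in Hu as [Oh ->]; apply is_VVE in Hu' as [Oh' ->].
destruct (ordinal_trichotomy Oh Oh') as [E|[->|E]]; auto.
- destruct (H' h E Hh).
- destruct (H h' E Hh').
Qed.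

End Predicates.

(** * The critical point and the least fixed ordinal above it *)

Section Embedding.

Context {M : set_model} {hZF : ZF M}.
Implicit Types (a b c d x y z f n p s w : M).

Variable C : M -> Prop.
Hypothesis definable_C : dfn1 C.
Hypothesis club_C : club_class C.

Variables D l m h h' j : M.
Hypothesis ordinal_D : ordinal D.
Hypothesis om_D : om ∈ D.
Hypothesis l_neq_m : l <> m.
Hypothesis C_l : C l.
Hypothesis height_h : height l h.
Hypothesis j_fun : is_fun j (V h) (V h').
Hypothesis j_select : forall d x y z x' y' z',
  d ∈ D -> maps j x x' -> maps j y y' -> maps j z z' ->
  (select 0 (predicates C) l d x y z <-> select 0 (predicates C) m d x' y' z').

Lemma image x : x ∈ V h -> exists x', maps j x x'.
Proof. intro Hx; destruct (fun_total j_fun Hx) as [y [_ Hy]]; eauto. Qed.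

Lemma image_unique x y y' : maps j x y -> maps j x y' -> y = y'.
Proof. apply (fun_functional j_fun). Qed.

Lemma dom x y : maps j x y -> x ∈ V h.
Proof. intro H; apply (fun_mem j_fun H). Qed.

Lemma limit_h : limit h.
Proof. apply height_h. Qed.

Lemma ordinal_h : ordinal h.
Proof. apply limit_h. Qed.

Lemma V_h_transitive x y : x ∈ V h -> y ∈ x -> y ∈ V h.
Proof. exact (V_transitive ordinal_h). Qed.

Lemma preserved i P x y z x' y' z' : nth_error (predicates C) i = Some P ->
  maps j x x' -> maps j y y' -> maps j z z' -> (P l x y z <-> P m x' y' z').
Proof.
intros Hi Hx Hy Hz.
rewrite <- (select_nth 0 l x y z Hi), <- (select_nth 0 m x' y' z' Hi).
apply j_select; auto.
exact (ordinal_trans ordinal_D om_D (num_om i)).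
Qed.

Lemma j_l : maps j l m.
Proof.
assert (l ∈ V h) as Hl
  by (apply ordinal_subset_V; [exact ordinal_h | apply height_h]).
destruct (image Hl) as [y Hy].
assert (y = m) as <-; auto.
exact (proj1 (preserved (i := 0) eq_refl Hy Hy Hy) eq_refl).
Qed.

Lemma l_not_fixed : ~ maps j l l.
Proof. intro H; exact (l_neq_m (image_unique H j_l)). Qed.

Lemma j_mem x y x' y' : maps j x x' -> maps j y y' -> (x ∈ y <-> x' ∈ y').
Proof. intros Hx Hy; exact (preserved (i := 1) eq_refl Hx Hy Hy). Qed.

Lemma j_empty x x' : maps j x x' -> (is_empty x <-> is_empty x').
Proof. intro H; exact (preserved (i := 2) eq_refl H H H). Qed.

Lemma j_succ x y x' y' :
  maps j x x' -> maps j y y' -> (is_succ x y <-> is_succ x' y').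
Proof. intros Hx Hy; exact (preserved (i := 3) eq_refl Hx Hy Hy). Qed.

Lemma j_ordinal x x' : maps j x x' -> (ordinal x <-> ordinal x').
Proof. intro H; exact (preserved (i := 4) eq_refl H H H). Qed.

Lemma j_bijection x y z x' y' z' : maps j x x' -> maps j y y' -> maps j z z' ->
  (bijection x y z <-> bijection x' y' z').
Proof. exact (preserved (i := 5) eq_refl). Qed.

Lemma j_cofinal_map x y z x' y' z' :
  maps j x x' -> maps j y y' -> maps j z z' ->
  (cofinal_map x y z <-> cofinal_map x' y' z').
Proof. exact (preserved (i := 6) eq_refl). Qed.

Lemma j_maps x y z x' y' z' : maps j x x' -> maps j y y' -> maps j z z' ->
  (maps x y z <-> maps x' y' z').
Proof. exact (preserved (i := 7) eq_refl). Qed.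

Lemma j_is_V x y x' y' :
  maps j x x' -> maps j y y' -> (is_V x y <-> is_V x' y').
Proof. intros Hx Hy; exact (preserved (i := 8) eq_refl Hx Hy Hy). Qed.

Lemma j_next x y x' y' :
  maps j x x' -> maps j y y' -> (next C x y <-> next C x' y').
Proof. intros Hx Hy; exact (preserved (i := 9) eq_refl Hx Hy Hy). Qed.

(** Here [om] is a parameter of the relation and not one of its arguments, so it stays in place on
    both sides. *)
Lemma j_sequence x y x' y' :
  maps j x x' -> maps j y y' -> (is_fun x om y <-> is_fun x' om y').
Proof. intros Hx Hy; exact (preserved (i := 10) eq_refl Hx Hy Hy). Qed.

Lemma j_satisfies x y z x' y' z' : maps j x x' -> maps j y y' -> maps j z z' ->
  (satisfies x y z <-> satisfies x' y' z').
Proof. exact (preserved (i := 11) eq_refl). Qed.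

Lemma j_least_equinumerous x y x' y' : maps j x x' -> maps j y y' ->
  (least_equinumerous x y <-> least_equinumerous x' y').
Proof. intros Hx Hy; exact (preserved (i := 12) eq_refl Hx Hy Hy). Qed.

Lemma j_least_bad x y x' y' :
  maps j x x' -> maps j y y' -> (least_bad x y <-> least_bad x' y').
Proof. intros Hx Hy; exact (preserved (i := 13) eq_refl Hx Hy Hy). Qed.

Lemma j_least_stage x y x' y' :
  maps j x x' -> maps j y y' -> (least_stage x y <-> least_stage x' y').
Proof. intros Hx Hy; exact (preserved (i := 14) eq_refl Hx Hy Hy). Qed.

Lemma j_pair x y z x' y' z' : maps j x x' -> maps j y y' -> maps j z z' ->
  (is_pair x y z <-> is_pair x' y' z').
Proof. exact (preserved (i := 15) eq_refl). Qed.

Definition critical (k : M) : Prop :=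
  ordinal k /\ k ∈ V h /\ ~ maps j k k /\ forall b, b ∈ k -> maps j b b.

Lemma critical_exists : exists k, critical k.
Proof.
destruct (@ordinal_least M hZF (fun x => x ∈ V h /\ ~ maps j x x))
  as [k [Ok [[Hk Hj] Hmin]]].
- dfn_auto.
- exists l; split; [exact (ordinal_C club_C C_l)|].
  split; [exact (dom j_l) | exact l_not_fixed].
- exists k; split; [|split; [|split]]; auto.
  intros b Hb; apply NNPP; intro H; apply (Hmin b Hb); split; auto.
  exact (V_h_transitive Hk Hb).
Qed.

(** * Sets fixed below the critical point, and its inaccessibility *)

Variable k : M.
Hypothesis critical_k : critical k.

Lemma ordinal_k : ordinal k.
Proof. apply critical_k. Qed.

Lemma k_V : k ∈ V h.
Proof. apply critical_k. Qed.

Lemma k_not_fixed : ~ maps j k k.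
Proof. apply critical_k. Qed.

Lemma fixed_below b : b ∈ k -> maps j b b.
Proof. apply critical_k. Qed.

(** If j(k) were below k, it would be fixed, and applying j to j(k) ∈ k would give j(k) ∈ j(k). *)
Lemma k_mem_image k' : maps j k k' -> k ∈ k'.
Proof.
intro Hk.
assert (ordinal k') as Ok' by (apply (j_ordinal Hk); exact ordinal_k).
destruct (ordinal_trichotomy ordinal_k Ok') as [H|[H|H]]; auto.
- subst k'; destruct (k_not_fixed Hk).
- destruct (@not_mem_self M hZF k').
  apply (j_mem (fixed_below H) Hk); auto.
Qed.

Lemma k_image : exists k', maps j k k' /\ k ∈ k'.
Proof.
destruct (image k_V) as [k' Hk]; exists k'; split; auto; apply k_mem_image, Hk.
Qed.

Lemma k_neq_sc b : k <> sc b.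
Proof.
intro E; destruct k_image as [k' [Hk Hkk']].
assert (b ∈ k) as Hb by (rewrite E; apply mem_sc; auto).
assert (is_succ b k') as H.
{ apply (j_succ (fixed_below Hb) Hk), is_succE, E. }
apply is_succE in H; rewrite <- E in H; subst k'.
exact (not_mem_self Hkk').
Qed.

Lemma k_not_om : ~ k ∈ om.
Proof.
intro H; apply om_cases in H as [H|[b [_ H]]]; [|exact (k_neq_sc H)].
destruct k_image as [k' [Hk Hkk']].
assert (is_empty k') as H' by (apply (j_empty Hk), is_emptyE, H).
exact (H' k Hkk').
Qed.

(** An ordinal of [D] outside [om] is named by a constant and therefore fixed. Natural numbers need
    the separate argument of [k_not_om], since some of their symbols are taken by the predicates. *)
Lemma D_k : D ∈ k \/ D = k.
Proof.
assert (~ k ∈ D) as H.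
{ intro H; destruct k_image as [k' [Hk Hkk']].
  assert (S := j_select H Hk Hk Hk).
  rewrite !select_constant in S by exact k_not_om.
  rewrite (proj1 S eq_refl) in Hkk'; exact (not_mem_self Hkk'). }
destruct (ordinal_trichotomy ordinal_D ordinal_k) as [|[|]]; tauto.
Qed.

Lemma below_D b : b ∈ D -> b ∈ k.
Proof.
intro Hb; destruct D_k as [H|<-]; auto; exact (ordinal_trans ordinal_k H Hb).
Qed.

Lemma nat_fixed n : n ∈ om -> maps j n n.
Proof.
intro Hn; apply fixed_below, below_D; exact (ordinal_trans ordinal_D om_D Hn).
Qed.

Lemma sc_below b : b ∈ k -> sc b ∈ k.
Proof.
intro Hb; destruct (ordinal_sc_le ordinal_k Hb) as [H|H]; auto.
destruct (k_neq_sc (eq_sym H)).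
Qed.

Lemma k_le_l : k = l \/ k ∈ l.
Proof.
apply ordinal_not_mem; [exact (ordinal_C club_C C_l)|exact ordinal_k|].
intro H; exact (l_not_fixed (fixed_below H)).
Qed.

Lemma l_h : l ∈ h.
Proof. apply height_h. Qed.

Lemma below_l_h b : b ∈ l -> b ∈ h.
Proof. exact (ordinal_trans ordinal_h l_h). Qed.

Lemma k_h : k ∈ h.
Proof. destruct k_le_l as [->|H]; [exact l_h|exact (below_l_h H)]. Qed.

Lemma ordinal_V b : b ∈ h -> b ∈ V h.
Proof. apply ordinal_subset_V, ordinal_h. Qed.

Lemma V_fixed b : b ∈ h -> maps j b b -> maps j (V b) (V b).
Proof.
intros Hb Hj; destruct (image (V_mem ordinal_h Hb)) as [w Hw].
assert (is_V b w) as H.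
{ apply (j_is_V Hj Hw), is_VVE; split; auto; exact (ordinal_mem ordinal_h Hb). }
apply is_VVE in H as [_ ->]; auto.
Qed.

Lemma below_k_h b : b ∈ k -> b ∈ h.
Proof. exact (ordinal_trans ordinal_h k_h). Qed.

(** By induction on [b]: since [V (sc c)] is fixed, a subset of [V c] is sent to a subset of [V c],
    and the two have the same elements because those of [V c] are fixed. Inaccessibility is tested
    on maps from stages of the hierarchy, so knowing the fixed ordinals would not suffice. *)
Lemma V_below_fixed b x : b ∈ k -> x ∈ V b -> maps j x x.
Proof.
assert (forall b, ordinal b -> b ∈ k -> forall w, is_V b w ->
  forall x, x ∈ w -> maps j x x) as H.
2:{ intros Hb; assert (ordinal b) as Ob by exact (ordinal_mem ordinal_k Hb).
    apply (H b Ob Hb); apply is_VVE; auto. }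
clear b x; apply (ordinal_ind (P := fun b => b ∈ k -> forall w, is_V b w ->
  forall x, x ∈ w -> maps j x x)); [dfn_auto|].
intros b Ob IH Hb w Hw x Hx; apply is_VVE in Hw as [_ ->].
apply mem_V in Hx as [c [Hc Hx]]; auto.
assert (c ∈ k) as Hck by exact (ordinal_trans ordinal_k Hb Hc).
assert (ordinal c) as Oc by exact (ordinal_mem ordinal_k Hck).
assert (forall y, y ∈ V c -> maps j y y) as IHc.
{ intros y Hy; apply (IH c Hc Hck (V c)); auto; apply is_VVE; auto. }
assert (sc c ∈ k) as Hsc by exact (sc_below Hck).
assert (maps j (V (sc c)) (V (sc c))) as HVsc
  by (apply V_fixed; [exact (below_k_h Hsc) | exact (fixed_below Hsc)]).
assert (forall y, y ∈ V (sc c) <-> subset y (V c)) as HV.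
{ intro y; rewrite (mem_V _ (ordinal_sc Oc)); split.
  - intros [d [Hd Hy]] z Hz; apply mem_sc in Hd as [Hd| ->]; auto.
    exact (V_mono Oc Hd (Hy z Hz)).
  - intro Hy; exists c; split; auto; apply mem_sc; auto. }
assert (x ∈ V h) as HxV.
{ apply (V_h_transitive (x := V (sc c))); [exact (dom HVsc) | apply HV, Hx]. }
destruct (image HxV) as [x' Hx'].
assert (subset x' (V c)) as Hxc by (apply HV, (j_mem Hx' HVsc), HV, Hx).
assert (x' = x) as E; [|rewrite E in Hx'; exact Hx'].
apply ext; intro y; split; intro Hy.
- apply (j_mem (IHc y (Hxc y Hy)) Hx'), Hy.
- apply (j_mem (IHc y (Hx y Hy)) Hx'), Hy.
Qed.

(* For f : X -> k with j the identity on X, j(f)(x) = j(f(x)) = f(x) for x in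
   X, hence j(f) cannot reach k. *)
Lemma k_not_value f f' X x :
  maps j f f' -> is_fun f X k -> (forall x, x ∈ X -> maps j x x) -> x ∈ X ->
  forall c, maps f' x c -> (forall y y', maps f' x y -> maps f' x y' -> y = y') ->
  c ∈ k.
Proof.
intros Hf Hfun HX Hx c Hc Hun.
destruct (fun_total Hfun Hx) as [y [Hy Hxy]].
assert (maps f' x y) as H by (apply (j_maps Hf (HX x Hx) (fixed_below Hy)), Hxy).
rewrite (Hun c y Hc H); auto.
Qed.

(** The image of a counterexample f is onto, respectively cofinal in, j(k) and must reach k ∈ j(k).
    By [k_not_value] all its values lie below k, because j is the identity on the domain of f. *)
Lemma inaccessible_k : inaccessible k.
Proof.
destruct k_image as [k' [Hk Hkk']]; split.
- split; [exact ordinal_k|]; intros b Hb [f Hf].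
  assert (f ∈ V h) as HfV.
  { apply (V_limit_fun limit_h (proj1 Hf)); [|exact k_V].
    exact (ordinal_V (below_k_h Hb)). }
  destruct (image HfV) as [f' Hf'].
  assert (bijection f' b k') as H
    by (apply (j_bijection Hf' (fixed_below Hb) Hk), Hf).
  destruct H as [H [_ Hsur]]; destruct (Hsur k Hkk') as [x Hx].
  apply (@not_mem_self M hZF k).
  apply (@k_not_value f f' b x Hf' (proj1 Hf)).
  + intros y Hy; apply fixed_below; exact (ordinal_trans ordinal_k Hb Hy).
  + exact (proj1 (fun_mem H Hx)).
  + exact Hx.
  + intros y y'; exact (fun_functional H).
- intros b v Hb Hv [f Hf]; apply is_VVE in Hv as [_ ->].
  assert (maps j (V b) (V b)) as HVb
    by (apply V_fixed; [exact (below_k_h Hb) | exact (fixed_below Hb)]).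
  assert (f ∈ V h) as HfV
    by exact (V_limit_fun limit_h (proj1 Hf) (dom HVb) k_V).
  destruct (image HfV) as [f' Hf'].
  assert (cofinal_map f' (V b) k') as [H Hcof]
    by (apply (j_cofinal_map Hf' HVb Hk), Hf).
  destruct (Hcof k Hkk') as [x [c [Hx [Hxc Hc]]]].
  assert (c ∈ k) as Hck.
  { apply (@k_not_value f f' (V b) x Hf' (proj1 Hf)); auto.
    - intros y; exact (V_below_fixed Hb).
    - intros y y'; exact (fun_functional H). }
  destruct Hc as [Hc|Hc]; [exact (not_mem_cycle2 Hc Hck)|].
  subst c; exact (not_mem_self Hck).
Qed.

(** * Fixed ordinals above the critical point *)

Hypothesis C_not_inaccessible : forall c, C c -> ~ inaccessible c.

Lemma fixed_above : exists g, k ∈ g /\ g ∈ l /\ maps j g g.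
Proof.
assert (~ C k) as HCk by (intro H; exact (C_not_inaccessible H inaccessible_k)).
assert (exists b, b ∈ k /\ forall c, c ∈ k -> C c -> ~ b ∈ c) as [b [Hb Hgap]].
{ apply NNPP; intro H; apply HCk; destruct club_C as [_ [_ Hcl]]; apply Hcl.
  - exact ordinal_k.
  - exists om; exact (below_D om_D).
  - intros b Hb; apply NNPP; intro G; apply H; exists b; split; auto.
    intros c Hc HCc Hbc; apply G; eauto. }
assert (b ∈ l) as Hbl.
{ destruct k_le_l as [<-|H]; auto.
  exact (ordinal_trans (ordinal_C club_C C_l) H Hb). }
assert (exists g, ordinal g /\ next C b g) as [g [Og Hg]].
{ destruct (@ordinal_least M hZF (fun c => C c /\ b ∈ c))
    as [g [Og [[Cg Hbg] Hmin]]]; [dfn_auto| |].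
  - exists l; split; auto; exact (ordinal_C club_C C_l).
  - exists g; split; auto; split; [|split]; auto.
    intros d Hd HCd Hbd; apply (Hmin d Hd); auto. }
(* Taking [l] from the club pays off here: [l] is itself an element of [C] above [b], so [g] is in
   the domain of [j]. *)
assert (g = l \/ g ∈ l) as Hgl.
{ apply ordinal_not_mem; [exact (ordinal_C club_C C_l)|auto|].
  intro H; destruct Hg as [_ [_ Hg]]; exact (Hg l H C_l Hbl). }
assert (g ∈ h) as Hgh
  by (destruct Hgl as [->|H]; [exact l_h | exact (below_l_h H)]).
destruct (image (ordinal_V Hgh)) as [g' Hg'].
assert (maps j g g) as Hfix.
{ assert (next C b g') as H by (apply (j_next (fixed_below Hb) Hg'), Hg).
  rewrite (next_unique club_C H Hg) in Hg'; exact Hg'. }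
exists g; split; [|split]; auto.
- destruct (ordinal_trichotomy ordinal_k Og) as [H|[H|H]]; auto.
  + subst g; destruct (k_not_fixed Hfix).
  + destruct (Hgap g H); apply Hg.
- destruct Hgl as [->|H]; auto; destruct (l_not_fixed Hfix).
Qed.

Definition least_fixed d : Prop :=
  ordinal d /\ k ∈ d /\ maps j d d /\ d ∈ l /\
  forall b, b ∈ d -> maps j b b -> b ∈ k.

Lemma least_fixed_exists : exists d, least_fixed d.
Proof.
destruct fixed_above as [g [Hkg [Hgl Hg]]].
assert (ordinal g) as Og
  by exact (ordinal_mem (ordinal_C club_C C_l) Hgl).
destruct (@ordinal_least M hZF (fun x => k ∈ x /\ maps j x x))
  as [d [Od [[Hkd Hd] Hmin]]]; [dfn_auto|eauto|].
exists d; split; [|split; [|split; [|split]]]; auto.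
- assert (g = d \/ d ∈ g) as [<-|H]; auto.
  + destruct (ordinal_trichotomy Od Og) as [H|[H|H]]; auto.
    destruct (Hmin g H); auto.
  + exact (ordinal_trans (ordinal_C club_C C_l) Hgl H).
- intros b Hb Hbj.
  destruct (ordinal_trichotomy ordinal_k (ordinal_mem Od Hb)) as [H|[H|H]]; auto.
  + destruct (Hmin b Hb); auto.
  + subst b; destruct (k_not_fixed Hbj).
Qed.

Variable d : M.
Hypothesis least_fixed_d : least_fixed d.

Lemma ordinal_d : ordinal d.
Proof. apply least_fixed_d. Qed.

Lemma k_d : k ∈ d.
Proof. apply least_fixed_d. Qed.

Lemma d_fixed : maps j d d.
Proof. apply least_fixed_d. Qed.

Lemma d_l : d ∈ l.
Proof. apply least_fixed_d. Qed.

Lemma fixed_below_d b : b ∈ d -> maps j b b -> b ∈ k.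
Proof. apply least_fixed_d. Qed.

Lemma below_d_V b : b ∈ d -> b ∈ V h.
Proof.
intro Hb; apply ordinal_V, below_l_h.
exact (ordinal_trans (ordinal_C club_C C_l) d_l Hb).
Qed.

Lemma cardinal_d : cardinal d.
Proof.
split; [exact ordinal_d|]; intros b Hb [f Hf].
assert (exists c, least_equinumerous d c) as [c Hc].
{ destruct (@ordinal_least M hZF (fun c => exists f, bijection f c d))
    as [c [Oc [[g Hg] Hmin]]]; [dfn_auto| |].
  - exists b; split; eauto; exact (ordinal_mem ordinal_d Hb).
  - exists c; split; [|split; eauto].
    destruct (ordinal_trichotomy Oc (ordinal_mem ordinal_d Hb)) as [H|[->|H]];
      auto.
    + exact (ordinal_trans ordinal_d Hb H).
    + destruct (Hmin b H); eauto. }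
clear b Hb f Hf; assert (Hc' := Hc); destruct Hc' as [Hcd [[f Hf] _]].
destruct (image (below_d_V Hcd)) as [c' Hc'].
assert (least_equinumerous d c') as H
  by (apply (j_least_equinumerous d_fixed Hc'), Hc).
rewrite (least_equinumerous_unique ordinal_d H Hc) in Hc'; clear H c'.
assert (c ∈ k) as Hck by exact (fixed_below_d Hcd Hc').
assert (f ∈ V h) as HfV
  by exact (V_limit_fun limit_h (proj1 Hf) (dom Hc') (dom d_fixed)).
destruct (image HfV) as [f' Hf'].
assert (bijection f' c d) as [H [_ Hsur]]
  by (apply (j_bijection Hf' Hc' d_fixed), Hf).
destruct (Hsur k k_d) as [x Hx].
assert (x ∈ c) as Hxc by exact (proj1 (fun_mem H Hx)).
assert (maps j x x) as Hjx
  by (apply fixed_below; exact (ordinal_trans ordinal_k Hck Hxc)).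
destruct (fun_total (proj1 Hf) Hxc) as [y [Hy Hxy]].
destruct (image (below_d_V Hy)) as [y' Hy'].
assert (y' = k) as ->
  by exact (fun_functional H (proj1 (j_maps Hf' Hjx Hy') Hxy) Hx).
destruct k_image as [k' [Hk Hkk']].
(* No ordinal [y] is mapped to [k]: those below [k] are fixed, [k] itself is moved, and those above
   [k] have an image above j(k), which exceeds [k]. *)
destruct (ordinal_trichotomy (ordinal_mem ordinal_d Hy) ordinal_k)
  as [G|[G|G]].
- rewrite (image_unique Hy' (fixed_below G)) in Hkk'.
  rewrite <- (image_unique Hy' (fixed_below G)) in G; exact (not_mem_self G).
- subst y; exact (k_not_fixed Hy').
- apply (j_mem Hk Hy') in G; exact (not_mem_cycle2 G Hkk').
Qed.

(** * Elementarity of the restrictions of the embedding *)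

Lemma up_fixed x y : maps j x x -> maps j y y -> maps j (up x y) (up x y).
Proof.
intros Hx Hy.
destruct (image (V_limit_up limit_h (dom Hx) (dom Hy))) as [p Hp].
assert (is_pair x y p) as H by (apply (j_pair Hx Hy Hp), is_pairE; auto).
apply is_pairE in H; rewrite H in Hp; exact Hp.
Qed.

Lemma op_fixed x y : maps j x x -> maps j y y -> maps j (op x y) (op x y).
Proof. intros; unfold op; apply up_fixed; apply up_fixed; auto. Qed.

Lemma tag_fixed i x : maps j x x -> maps j (op (num i) x) (op (num i) x).
Proof. intro; apply op_fixed; auto; apply nat_fixed, num_om. Qed.

Lemma term_fixed t : is_term (set_sig (M := M)) t -> maps j t t.
Proof.
intro Ht; apply is_termE in Ht; auto; apply mem_variables in Ht as [n [Hn ->]].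
apply (tag_fixed 0), nat_fixed, Hn.
Qed.

(** Codes may be nonstandard, so an external induction on formulas is impossible. Instead, the fixed
    points of [j] form a set of the model that is closed under the formation rules. *)
Lemma formula_fixed p : is_formula (set_sig (M := M)) p -> maps j p p.
Proof.
destruct (@sep_exists M hZF (fun p => maps j p p)) with (a := V h) as [Z HZ];
  [dfn_auto|].
assert (forall x, x ∈ Z <-> maps j x x) as HZ'.
{ intro x; rewrite HZ; split; [tauto|intro H; split; auto; exact (dom H)]. }
intro Hp; apply HZ', Hp; split; [|split; [|split; [|split]]].
- intros t u c Ht Hu Hc; apply tag2E in Hc; subst c.
  apply HZ', tag_fixed, op_fixed; apply term_fixed; auto.
- intros r n u c Hr [Y Hu] Ht Hc; apply tag2E in Hc; subst c.
  apply set_sig_arity in Hr as [-> ->].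
  apply HZ', tag_fixed, op_fixed; [exact (nat_fixed emp_om)|].
  assert (forall i, i ∈ num 2 <-> i = num 0 \/ i = num 1) as H2.
  { intro i; simpl; rewrite !mem_sc; assert (G := @not_mem_emp M hZF i); tauto. }
  assert (num 0 ∈ num 2) as N0 by (apply H2; auto).
  assert (num 1 ∈ num 2) as N1 by (apply H2; auto).
  destruct (fun_total Hu N0) as [t0 [_ H0]], (fun_total Hu N1) as [t1 [_ H1]].
  (* The only relation symbol is binary, so the tuple of arguments is an explicit finite set built
     from fixed elements. *)
  assert (u = up (op (num 0) t0) (op (num 1) t1)) as ->.
  { apply ext; intro q; rewrite mem_up; split.
    - intro Hq; assert (Hq' := fun_subset_prod Hu Hq).
      apply mem_prod in Hq' as [i [t [Hi [_ ->]]]].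
      apply mapsE in Hq; apply H2 in Hi as [->| ->].
      + rewrite (fun_functional Hu Hq H0); auto.
      + rewrite (fun_functional Hu Hq H1); auto.
    - intros [->| ->]; apply mapsE; auto. }
  apply up_fixed; apply tag_fixed, term_fixed; eauto.
- intros q c Hq Hc; apply tagE in Hc; subst c; apply HZ' in Hq.
  apply HZ', tag_fixed, Hq.
- intros q q' c Hq Hq' Hc; apply tag2E in Hc; subst c; apply HZ' in Hq, Hq'.
  apply HZ', tag_fixed, op_fixed; auto.
- intros n q c Hn Hq Hc; apply tag2E in Hc; subst c; apply HZ' in Hq.
  apply HZ', tag_fixed, op_fixed; auto; apply nat_fixed, naturalE, Hn.
Qed.

Lemma restriction_exists w : maps j w w ->
  exists i, is_fun i w w /\ forall x y, maps i x y <-> x ∈ w /\ maps j x y.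
Proof.
intro Hw.
assert (forall x y, x ∈ w -> maps j x y -> y ∈ w) as H.
{ intros x y Hx Hxy; apply (j_mem Hxy Hw), Hx. }
destruct (@fun_exists M hZF (fun x y => maps j x y) w w) as [i [Hi Him]];
  [dfn_auto| | |].
- intros x Hx; destruct (image (V_h_transitive (dom Hw) Hx)) as [y Hy]; eauto.
- intros x y y' _; apply image_unique.
- exists i; split; auto; intros x y; rewrite Him; split; [tauto|].
  intros [Hx Hxy]; eauto.
Qed.

(** The relation [satisfies] is preserved and both [w] and the formula code are fixed, so only the
    assignment moves. Its image under [j] is the pointwise image, because every natural number is
    fixed. *)
Lemma restriction_elementary w i A : maps j w w -> is_fun i w w ->
  (forall x y, maps i x y <-> x ∈ w /\ maps j x y) -> is_mem_structure w A ->
  elementary (set_sig (M := M)) A A i.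
Proof.
intros Hw Hi Him HA.
assert (univ A = w) as EA by apply HA.
split; [rewrite EA; auto|].
intros p s s' Hp Hs Hs' Hss'.
rewrite <- !(satisfiesE p _ HA).
apply assignmentE in Hs; apply assignmentE in Hs'; rewrite EA in Hs, Hs'.
assert (s ∈ V h) as HsV.
{ apply (V_limit_fun limit_h Hs); [|exact (dom Hw)].
  apply ordinal_V, height_h. }
destruct (image HsV) as [t Ht].
assert (is_fun t om w) as Htf by (apply (j_sequence Ht Hw), Hs).
assert (s' = t) as ->; [|exact (j_satisfies Hw (formula_fixed Hp) Ht)].
symmetry; apply (fun_ext Htf Hs').
intros n y Hn Hny.
destruct (fun_total Hs Hn) as [x [Hx Hnx]].
destruct (fun_total Hi Hx) as [x' [_ Hx']].
assert (maps j x x') as Hjx by (apply Him in Hx'; tauto).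
rewrite (fun_functional Htf Hny (proj1 (j_maps Ht (nat_fixed Hn) Hjx) Hnx)).
exact (Hss' n x x' Hnx Hx').
Qed.

Lemma rank_Berkeley_d : rank_Berkeley d.
Proof.
split; [exact cardinal_d|].
intros z0 Hz0; split; [exact cardinal_d|split; auto].
intros b0 Ob0 Hb0; apply NNPP; intro Hno.
(* Neither [z0] nor [b0] has to be fixed by [j]; they only guarantee that the least counterexamples
   exist. *)
assert (exists z, least_bad d z) as [z Hz].
{ destruct (@ordinal_least M hZF (fun z => z ∈ d /\ exists b, no_embedding d z b))
    as [z [Oz [[Hz Hb] Hmin]]].
  - unfold no_embedding; dfn_auto.
  - exists z0; split; [exact (ordinal_mem ordinal_d Hz0)|split; auto].
    exists b0; split; [|split]; auto.
  - exists z; split; [|split; [|split]]; auto.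
    intros y Hy Hyb; apply (Hmin y Hy); split; auto.
    exact (ordinal_trans ordinal_d Hz Hy). }
assert (exists b, least_stage d b) as [b Hb].
{ destruct Hz as [Oz [Hzd [[b Hb] Hmin]]].
  destruct (@ordinal_least M hZF (fun b => no_embedding d z b))
    as [c [Oc [Hc Hcmin]]].
  - unfold no_embedding; dfn_auto.
  - exists b; split; auto; apply Hb.
  - exists c, z; split; [|split]; auto; split; [|split; [|split]]; eauto. }
assert (z ∈ d) as Hzd by apply Hz.
destruct (image (below_d_V Hzd)) as [z' Hz'].
assert (least_bad d z') as H by (apply (j_least_bad d_fixed Hz'), Hz).
rewrite (least_bad_unique H Hz) in Hz'; clear H z'.
assert (z ∈ k) as Hzk by exact (fixed_below_d Hzd Hz').
assert (b ∈ h) as Hbh.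
{ destruct height_h as [_ [_ [_ Hst]]]; exact (Hst d b d_l Hb). }
destruct (image (ordinal_V Hbh)) as [b' Hb'].
assert (least_stage d b') as H by (apply (j_least_stage d_fixed Hb'), Hb).
rewrite (least_stage_unique H Hb) in Hb'; clear H b'.
destruct Hb as [y [Hy [[Ob [Hdb Hbad]] _]]].
rewrite (least_bad_unique Hy Hz) in Hbad; apply Hbad.
assert (Hw := V_fixed Hbh Hb').
destruct (restriction_exists Hw) as [i [Hi Him]].
destruct (mem_structure_exists (V b)) as [A HA].
assert (d ∈ V b) as HdV by exact (ordinal_subset_V Ob Hdb).
assert (k ∈ V b) as HkV by exact (V_transitive Ob HdV k_d).
exists i, k; split; [|split; [|split; [|split]]].
- exists (V b), set_sig, A; split; [apply is_VVE; auto|].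
  split; [apply set_signatureE; auto|split; auto].
  exact (restriction_elementary Hw Hi Him HA).
- destruct k_image as [k' [Hk Hkk']].
  split; [exact ordinal_k|split].
  + exists k'; split; [apply Him; auto|].
    intros ->; exact (not_mem_self Hkk').
  + intros c Hc; apply Him; split; [|exact (fixed_below Hc)].
    exact (V_transitive Ob HkV Hc).
- exact Hzk.
- exact k_d.
- apply Him; split; auto; exact d_fixed.
Qed.

End Embedding.

Theorem theorem6p10 (M : set_model) (hZF : ZF M) (hVP : VP M)
    (hM : OR_not_Mahlo M) :
  forall a : M, ordinal a -> exists d : M, a ∈ d /\ rank_Berkeley d.
Proof.
intros a Ha.
destruct hM as [C [defC [_ [club_C HC]]]].
assert (dfn1 C) as dfn_C by (intros t Ht; apply dfn_definable; auto).
(* This is the larger of a + 1 and ω + 1. With [a] and [om] among the symbols, both lie below the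
   critical point. *)
set (D := un (up (sc a) (sc om))).
assert (ordinal D) as OD.
{ apply ordinal_un; intros x Hx; apply mem_up in Hx as [->| ->];
    apply ordinal_sc; auto; exact ordinal_om. }
assert (a ∈ D) as HaD
  by (apply mem_un; exists (sc a); rewrite mem_up, mem_sc; auto).
assert (om ∈ D) as HomD
  by (apply mem_un; exists (sc om); rewrite mem_up, mem_sc; auto).
destruct (@VP_ternary M hZF D (select 0 (predicates C)))
  with (index := C) (universe := universe (M := M))
  as [l [m [u [v [j [Hlm [Hl [Hm [Hu [Hv [Hj Hsel]]]]]]]]]]]; auto.
- intros; apply dfn_select; auto; apply dfn_predicates; auto.
- apply dfn_universe.
- exact (C_unbounded club_C).
- exact (universe_exists club_C).
- exact universe_unique.
- destruct Hu as [h [Hh [_ Hu]]], Hv as [h' [_ [_ Hv]]].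
  apply is_VVE in Hu as [_ ->]; apply is_VVE in Hv as [_ ->].
  destruct (critical_exists club_C OD HomD Hlm Hl Hh Hj Hsel) as [k Hk].
  destruct (least_fixed_exists dfn_C club_C OD HomD Hlm Hl Hh Hj Hsel Hk HC)
    as [d Hd].
  exists d; split.
  + apply (ordinal_trans (b := k)); [apply Hd|apply Hd|].
    exact (below_D OD HomD Hj Hsel Hk HaD).
  + exact (rank_Berkeley_d club_C OD HomD Hl Hh Hj Hsel Hk Hd).
Qed.
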